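(* The following hold for a Banach space $X$. (1) If every normalized basic sequence in $X$ is Haar-$\ell_1^+$, then every spreading model of $X$ is equivalent to the unit vector basis of $\ell_1$. (2) Let $(e_i)$ be a normalized basic sequence in $X$. If every asymptotic model generated by an array of normalized block bases of $(e_i)$ is equivalent to the unit vector basis of $\ell_1$, then $(e_i)$ is a Haar-$\ell_1^+$ sequence. In particular, $X$ has the Lebesgue property if every asymptotic model of $X$ is equivalent to the unit vector basis of $\ell_1$.
   Context: $\mathbb{N}=\{1,2,3,\dots\}$. Lebesgue property. A function $f:[0,1]\to X$ is Riemann-integrable if there is $x_f\in X$ such that for every $\varepsilon>0$ there is $\delta>0$ with $\|x_f-\sum_{i=1}^d(p_i-p_{i-1})f(t_i)\|<\varepsilon$ for every partition $0=p_0<p_1<\dots<p_d=1$ with $\max_i(p_i-p_{i-1})<\delta$ and every choice of tags $t_i\in[p_{i-1},p_i]$. $X$ has the Lebesgue property if every Riemann-integrable function $f:[0,1]\to X$ is continuous at Lebesgue almost every point of $[0,1]$. Basic sequences. A sequence $(e_i)$ is basic if it is a Schauder basis of its closed linear span; equivalently, there is $K\ge1$ with $\|\sum_{i=1}^n a_ie_i\|\le K\|\sum_{i=1}^m a_ie_i\|$ for all $m\ge n$ and all scalars $(a_i)$, and all $e_i\neq 0$ (it is then called $K$-basic; the same terminology is used for finite sequences). It is normalized if $\|e_i\|=1$ for all $i$. A block basis of $(e_i)$ is a sequence $(x_j)$ of nonzero finitely supported vectors (with respect to $(e_i)$) with $\max\operatorname{supp}(x_j)<\min\operatorname{supp}(x_{j+1})$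 for all $j$. Basic sequences $(e_i)$ and $(e_i')$ are equivalent if there is $C>0$ such that $\frac1C\|\sum_{i=1}^n a_ie_i'\|\le\|\sum_{i=1}^n a_ie_i\|\le C\|\sum_{i=1}^n a_ie_i'\|$ for every $n$ and all scalars $(a_i)$. Haar system of partitions. A collection $(A^n_j)_{n\in\mathbb{N},\,0\le j\le 2^n-1}$ of infinite subsets of $\mathbb{N}$ is a Haar system of partitions of $\mathbb{N}$ if (1) for every $n\in\mathbb{N}$, $\bigcup_{j=0}^{2^n-1}A^n_j=\mathbb{N}$ and $A^n_j\cap A^n_{j'}=\emptyset$ for $j\neq j'$; (2) for every $n\in\mathbb{N}$ and $0\le j\le 2^n-1$, $A^n_j=A^{n+1}_{2j}\cup A^{n+1}_{2j+1}$. Haar-$\ell_1^+$. A normalized basic sequence $(e_i)$ is Haar-$\ell_1^+$ if for every Haar system of partitions $(A^n_j)$ of $\mathbb{N}$ there exists $C\ge 1$ such that $$\frac1C\le \lim_{n\to\infty}\sup\left\{\frac{1}{2^m}\left\|\sum_{j=0}^{2^m-1}e_{i_j}\right\| : m\ge n \text{ and } 2^m\le i_j\in A^m_j \text{ for } 0\le j\le 2^m-1\right\}.$$ Spreading model. Let $(e_i)$ be a normalized basic sequence in $X$ and $(v_i)$ a normalized Schauder basis of a Banach space $(V,\|\cdot\|_V)$. If there exist positive reals $\delta_n\searrow 0$ such that for every $n$, $\left|\|\sum_{j=1}^n a_je_{i_j}\|-\|\sum_{i=1}^n a_iv_i\|_V\right|<\delta_n$ for all integers $n\le i_1<\dots<i_n$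 and all scalars $|a_i|\le1$, then $(v_i)$ is a spreading model of $X$ generated by $(e_i)$. Asymptotic model. An array $(e^j_i)_{i,j\in\mathbb{N}}$ in $X$ is $C$-basic if for every $j$ the row $(e^j_i)_{i}$ is a normalized $C$-basic sequence and, for all integers $n\le i_1<\dots<i_n$, the diagonal sequence $(e^j_{i_j})_{j=1}^n$ is $C$-basic. Let $(e^j_i)$ be a $C$-basic array in $X$ (for some $C$) and $(v_i)$ a normalized Schauder basis of a Banach space $(V,\|\cdot\|_V)$. If there exist positive reals $\delta_n\searrow0$ such that for every $n$, $\left|\|\sum_{j=1}^n a_je^j_{i_j}\|-\|\sum_{i=1}^n a_iv_i\|_V\right|<\delta_n$ for all integers $n\le i_1<\dots<i_n$ and all scalars $|a_i|\le1$, then $(v_i)$ is an asymptotic model of $X$ generated by $(e^j_i)$. An array of normalized block bases of $(e_i)$ is an array each of whose rows $(e^j_i)_i$ is a normalized block basis of $(e_i)$. *)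

(* Defs.v *)
From HB Require Import structures.
From mathcomp Require Import all_boot all_order all_algebra.
From mathcomp Require Import all_classical all_reals all_analysis.
Set Implicit Arguments.
Unset Strict Implicit.
Unset Printing Implicit Defensive.
Import Order.TTheory GRing.Theory Num.Theory.
Import numFieldNormedType.Exports.
Local Open Scope classical_set_scope.
Local Open Scope ring_scope.

(* Conventions.  Banach spaces are real.  With N = {1, 2, 3, ...}, a sequence
   (e_i), i in N, is encoded as e : nat -> X where [e i] stands for e_{i+1}.
   Likewise a natural number [i] used as a position in a sequence, or as an
   element of a subset of N, stands for i + 1; so the condition "k <= i" on
   such a position reads [k <= i.+1].  Lengths (n), levels of partitions (n, m)
   and the index j of A^n_j are not shifted.  A finite sequence of length n is
   a function on nat of which only the values at 0, ..., n - 1 are used. *)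

(* The function is given on all of R, but only its values on [0, 1] are used. *)
Definition riemann_integrable (R : realType) (X : completeNormedModType R)
    (f : R -> X) : Prop :=
  exists xf : X, forall eps : R, 0 < eps ->
    exists2 delta : R, 0 < delta &
    forall (d : nat) (p t : nat -> R),
      p 0%N = 0 -> p d = 1 ->
      (forall i, (i < d)%N -> p i < p i.+1) ->
      (forall i, (i < d)%N -> p i.+1 - p i < delta) ->
      (forall i, (i < d)%N -> p i <= t i <= p i.+1) ->
      `|xf - \sum_(i < d) (p i.+1 - p i) *: f (t i)| < eps.

(* Continuity at x is relative to [0, 1]. *)
Definition lebesgue_property (R : realType) (X : completeNormedModType R) :
    Prop :=
  forall f : R -> X, riemann_integrable f ->
    {ae @lebesgue_measure R, forall x : R, 0 <= x <= 1 ->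
       f y @[y --> within `[0%R, 1%R] (nbhs x)] --> f x}.

Definition normalized (R : realType) (X : completeNormedModType R)
    (e : nat -> X) : Prop :=
  forall i, `|e i| = 1.

Definition K_basic (R : realType) (X : completeNormedModType R) (K : R)
    (e : nat -> X) : Prop :=
  [/\ 1 <= K, forall i, e i != 0 &
   forall (a : nat -> R) (n m : nat), (n <= m)%N ->
     `|\sum_(i < n) a i *: e i| <= K * `|\sum_(i < m) a i *: e i| ].

Definition K_basic_fin (R : realType) (X : completeNormedModType R) (K : R)
    (N : nat) (e : nat -> X) : Prop :=
  [/\ 1 <= K, forall i, (i < N)%N -> e i != 0 &
   forall (a : nat -> R) (n m : nat), (n <= m <= N)%N ->
     `|\sum_(i < n) a i *: e i| <= K * `|\sum_(i < m) a i *: e i| ].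

Definition basic (R : realType) (X : completeNormedModType R)
    (e : nat -> X) : Prop :=
  exists K : R, K_basic K e.

Definition schauder_basis (R : realType) (V : completeNormedModType R)
    (v : nat -> V) : Prop :=
  forall x : V, exists! a : nat -> R,
    (\sum_(i < n) a i *: v i) @[n --> \oo] --> x.

(* The norm of \sum_(i < n) a_i u_i in l_1, where (u_i) is the unit vector
   basis, is \sum_(i < n) |a_i|. *)
Definition equivalent_to_ell1_basis (R : realType)
    (V : completeNormedModType R) (v : nat -> V) : Prop :=
  exists2 C : R, 0 < C &
  forall (n : nat) (a : nat -> R),
    C^-1 * (\sum_(i < n) `|a i|) <= `|\sum_(i < n) a i *: v i|
      <= C * (\sum_(i < n) `|a i|).

Definition block_basis (R : realType) (X : completeNormedModType R)
    (e x : nat -> X) : Prop :=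
  (forall j, x j != 0) /\
  exists (N : nat -> nat) (c : nat -> nat -> R),
    [/\ forall j i, (N j <= i)%N -> c j i = 0,
        forall j, x j = \sum_(i < N j) c j i *: e i &
        forall j i k, c j i != 0 -> c j.+1 k != 0 -> (i < k)%N].

(* Only the levels n >= 1 of A are constrained. *)
Definition haar_system (A : nat -> nat -> set nat) : Prop :=
  [/\ forall n j, (0 < n)%N -> (j < 2 ^ n)%N -> infinite_set (A n j),
      forall n, (0 < n)%N -> \bigcup_(j in `I_(2 ^ n)) A n j = setT,
      forall n, (0 < n)%N -> trivIset `I_(2 ^ n) (A n) &
      forall n j, (0 < n)%N -> (j < 2 ^ n)%N ->
        A n j = A n.+1 (2 * j)%N `|` A n.+1 (2 * j).+1].

(* For e normalized, these averages have norm at most 1; for n >= 1 and A a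
   Haar system, the set is nonempty and nonincreasing in n.  So [sup] below is
   a genuine supremum and [limn] a genuine limit. *)
Definition haar_averages (R : realType) (X : completeNormedModType R)
    (e : nat -> X) (A : nat -> nat -> set nat) (n : nat) : set R :=
  [set r | exists (m : nat) (i : nat -> nat),
    [/\ (n <= m)%N,
        forall j, (j < 2 ^ m)%N -> (2 ^ m <= (i j).+1)%N /\ A m j (i j) &
        r = (2 ^+ m)^-1 * `|\sum_(j < 2 ^ m) e (i j)| ]].

Definition haar_ell1_plus (R : realType) (X : completeNormedModType R)
    (e : nat -> X) : Prop :=
  forall A : nat -> nat -> set nat, haar_system A ->
    exists2 C : R, 1 <= C &
      C^-1 <= limn (fun n => sup (haar_averages e A n)).

(* n <= i_1 < ... < i_n *)
Definition admissible (n : nat) (i : nat -> nat) : Prop :=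
  (forall j, (j < n)%N -> (n <= (i j).+1)%N) /\
  (forall j k, (j < k < n)%N -> (i j < i k)%N).

(* [e j i] is e^j_i: the rows are the sequences [e j]. *)
Definition basic_array (R : realType) (X : completeNormedModType R) (C : R)
    (e : nat -> nat -> X) : Prop :=
  (forall j, normalized (e j) /\ K_basic C (e j)) /\
  (forall (n : nat) (i : nat -> nat), admissible n i ->
     K_basic_fin C n (fun j => e j (i j))).

Definition asymptotically_isometric (R : realType)
    (X V : completeNormedModType R) (e : nat -> nat -> X) (v : nat -> V) :
    Prop :=
  exists delta : nat -> R,
    [/\ forall n, 0 < delta n, nonincreasing_seq delta,
        delta n @[n --> \oo] --> 0 &
     forall (n : nat) (i : nat -> nat) (a : nat -> R), admissible n i ->
       (forall j, (j < n)%N -> `|a j| <= 1) ->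
       `| `|\sum_(j < n) a j *: e j (i j)| - `|\sum_(j < n) a j *: v j| |
         < delta n].

Definition spreading_model (R : realType) (X V : completeNormedModType R)
    (e : nat -> X) (v : nat -> V) : Prop :=
  [/\ normalized e, basic e, normalized v, schauder_basis v &
      asymptotically_isometric (fun=> e) v].

Definition asymptotic_model (R : realType) (X V : completeNormedModType R)
    (e : nat -> nat -> X) (v : nat -> V) : Prop :=
  [/\ exists C : R, basic_array C e, normalized v, schauder_basis v &
      asymptotically_isometric e v].

(* Main.v *)
(** (1) A spreading model [v] is a spreading sequence.  Applied to the
    normalized differences [e (2i+1) - e (2i+2)], the Haar-l1+ property gives
    [|d_0 + ... + d_(M-1)| >= c M] for [d_j = v (2j) - v (2j+1)].  Shifting the
    negative terms of a combination of the [d_j] and averaging makes them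
    telescope away, and averaging translates of a nonnegative combination
    flattens its coefficients; hence [d], and then [v], is equivalent to the
    l1 basis.

    (2) List the sets [A^m_j] as [B_k], [k = 2^m + j].  From a normalized basic
    sequence [w] one extracts an array of subsequences of [w] whose row [k]
    lies in [B_k] and which generates an asymptotic model; the limit norm is an
    iterated limit along a nonprincipal ultrafilter, and the model is realized
    on the space of its convergent series.  The l1 lower bound on rows [2^m] to
    [2^(m+1) - 1] bounds the Haar averages from below.

    (3) If [f] is Riemann integrable but not almost everywhere continuous, then
    for some [c > 0] a fixed proportion of the dyadic intervals of every level
    contains differences [f t - f t'] of norm at least [c].  Integrability
    makes averages of such differences small, so that differences can be found
    which almost preserve the norm of any finite-dimensional subspace: this
    yields a basic sequence of differences in which every relevant dyadic
    interval occurs infinitely often.  In an asymptotic model built from it as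
    in (2), the l1 lower bound contradicts the smallness of the sum over the
    intervals of a fine level. *)

Require Import Defs.
From HB Require Import structures.
From mathcomp Require Import all_boot all_order all_algebra.
From mathcomp Require Import all_classical all_reals all_analysis.
From mathcomp Require Import ring lra zify.
Import Order.TTheory GRing.Theory Num.Theory.
Import numFieldNormedType.Exports.
Local Open Scope classical_set_scope.
Local Open Scope ring_scope.

Set Implicit Arguments.
Unset Strict Implicit.
Unset Printing Implicit Defensive.

(** * The Banach space spanned by a basis with prescribed norm *)

Definition tail (R : realType) (n : nat) (a : nat -> R) : nat -> R :=
  fun i => if (i < n)%N then 0 else a i.

(* [bn n a] stands for the norm of [\sum_(i < n) a i *: v i], where [v] is the
   basis to be constructed. *)
Record basis_norm (R : realType) := BasisNorm {
  bn : nat -> (nat -> R) -> R;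
  bn_const : R;
  bnD : forall n a b, bn n (a + b) <= bn n a + bn n b;
  bnZ : forall n l a, bn n (l *: a) = `|l| * bn n a;
  bn_eq : forall n a b, (forall i, (i < n)%N -> a i = b i) -> bn n a = bn n b;
  bn_stable : forall n m a, (n <= m)%N ->
    (forall i, (n <= i < m)%N -> a i = 0) -> bn m a = bn n a;
  bn_const_ge1 : 1 <= bn_const;
  bn_basic : forall n m a, (n <= m)%N -> bn n a <= bn_const * bn m a;
  bn_unit : forall i, bn i.+1 (fun k => (k == i)%:R) = 1
}.

Section BasisSpace.
Variables (R : realType) (N : basis_norm R).
Local Notation K := (bn_const N).
Implicit Types (a b : nat -> R) (n m : nat).

Let scaleE (l : R) a i : (l *: a) i = l * a i. Proof. by []. Qed.
Let addE a b i : (a + b) i = a i + b i. Proof. by []. Qed.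
Let subE a b i : (a - b) i = a i - b i. Proof. by []. Qed.

Lemma bn0 n : bn N n 0 = 0.
Proof. by rewrite -(scale0r 0) bnZ normr0 mul0r. Qed.

Lemma bnN n a : bn N n (- a) = bn N n a.
Proof. by rewrite -scaleN1r bnZ normrN1 mul1r. Qed.

Lemma bn_ge0 n a : 0 <= bn N n a.
Proof.
have := bnD N n a (- a); rewrite subrr bn0 bnN -mulr2n.
by rewrite pmulrn_lge0.
Qed.

Lemma bn_dist n a b : `|bn N n a - bn N n b| <= bn N n (a - b).
Proof.
rewrite ler_norml; apply/andP; split; last first.
  by rewrite lerBlDr -[X in bn N n X <= _](subrK b) bnD.
rewrite lerNl opprB lerBlDr -(bnN n (a - b)) opprB.
by rewrite -[X in bn N n X <= _](subrK a) bnD.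
Qed.

Lemma bn_delta i n : (i < n)%N -> bn N n (fun k => (k == i)%:R) = 1.
Proof.
move=> lin; rewrite -[RHS](bn_unit N i); apply: bn_stable => // k /andP[lik _].
by rewrite gtn_eqF.
Qed.

(** Triangle inequality, adding one unit vector of norm 1 at a time to the truncations of [a]. *)
Lemma bn_le_sum n a : bn N n a <= \sum_(i < n) `|a i|.
Proof.
have H m : (m <= n)%N ->
    bn N n (fun k => if (k < m)%N then a k else 0) <= \sum_(i < m) `|a i|.
  elim: m => [_|m IH mn].
    by rewrite big_ord0 (_ : (fun _ => _) = 0) ?bn0.
  rewrite big_ord_recr /=; apply: (le_trans _ (lerD (IH (ltnW mn)) (lexx _))).
  rewrite -[X in _ <= _ + X]mulr1 -(bn_delta mn) -bnZ.
  apply: le_trans (bnD _ _ _ _); rewrite le_eqVlt; apply/orP; left; apply/eqP.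
  apply: bn_eq => i _; rewrite addE scaleE ltnS leq_eqVlt.
  have [->|] := eqVneq i m; first by rewrite ltnn /= add0r mulr1.
  by move=> _; rewrite mulr0 addr0.
have /(_ n (leqnn n)) := H.
by rewrite (@bn_eq _ N n _ a) // => i ->.
Qed.

(** The coordinate is the difference of two consecutive partial sums, and the shorter one costs a
    factor [K]. *)
Lemma bn_coord n a : `|a n| <= (1 + K) * bn N n.+1 a.
Proof.
have -> : `|a n| = bn N n.+1 (tail n a).
  rewrite -[LHS]mulr1 -(bn_unit N n) -bnZ; apply: bn_eq => i lin.
  rewrite scaleE /tail; rewrite ltnS in lin.
  case: (ltngtP i n) lin => [_ _|//|-> _]; first by rewrite mulr0.
  by rewrite mulr1.
rewrite mulrDl mul1r; apply: le_trans (lerD (lexx _) (bn_basic _ _ (leqnSn n))).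
rewrite -(bnN n).
have -> : bn N n (- a) = bn N n.+1 (tail n a - a).
  rewrite (@bn_stable _ N n n.+1 (tail n a - a)) => //; last first.
    move=> i; rewrite ltnS -eqn_leq => /eqP <-.
    by rewrite subE /tail ltnn subrr.
  by apply: bn_eq => i lin; rewrite subE /tail lin add0r.
by rewrite -[X in bn N _ X <= _](subrK a) addrC bnD.
Qed.

Lemma tailD n a b : tail n (a + b) = tail n a + tail n b.
Proof.
apply/funext => i; rewrite /tail /GRing.add /=.
by case: ifP; rewrite ?addr0.
Qed.

Lemma tailZ n (l : R) a : tail n (l *: a) = l *: tail n a.
Proof.
apply/funext => i; rewrite /tail !scaleE.
by case: ifP; rewrite ?mulr0.
Qed.

Lemma bn_tail m n a : bn N m (tail n a) <= (1 + K) * bn N m a.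
Proof.
have K0 : 0 <= K by apply: le_trans ler01 (bn_const_ge1 N).
have [mn|nm] := leqP m n.
  rewrite (_ : bn N m _ = 0) ?mulr_ge0 ?bn_ge0 ?addr_ge0 //.
  rewrite -(bn0 m); apply: bn_eq => i im.
  by rewrite /tail (leq_trans im mn).
rewrite mulrDl mul1r; apply: le_trans (lerD (lexx _) (bn_basic _ _ (ltnW nm))).
rewrite -(bnN n).
have -> : bn N n (- a) = bn N m (tail n a - a).
  rewrite (@bn_stable _ N n m (tail n a - a) (ltnW nm)) => //; last first.
    move=> i /andP[ni _].
    by rewrite subE /tail ltnNge ni subrr.
  apply: bn_eq => i lin.
  by rewrite subE /tail lin add0r.
by rewrite -[X in bn N _ X <= _](subrK a) addrC bnD.
Qed.

(** Coefficient sequences with a Cauchy series: [bn N m (tail n a)] is the norm of the block of [a]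
    from [n] to [m - 1]. *)
Definition convergent_series : pred (nat -> R) := fun a =>
  `[< forall eps, 0 < eps -> \forall n \near \oo,
        forall m, bn N m (tail n a) <= eps >].

Lemma convergent_series_submod : submod_closed convergent_series.
Proof.
split=> [|l a b /asboolP Pa /asboolP Pb]; apply/asboolP => eps e0.
  near=> n => m; rewrite (_ : tail n 0 = 0) ?bn0 ?ltW //.
  by apply/funext => i; rewrite /tail; case: ifP.
have d0 : 0 < eps / 2 / (`|l| + 1) by rewrite !divr_gt0 // ltr_pwDr.
have h0 : 0 < eps / 2 by rewrite divr_gt0.
near=> n => m; rewrite tailD tailZ; apply: le_trans (bnD _ _ _ _) _.
rewrite [leRHS]splitr lerD //; last first.
  by move: m; near: n; exact: Pb.
rewrite bnZ.
have : bn N m (tail n a) <= eps / 2 / (`|l| + 1).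
  by move: m; near: n; exact: Pa.
rewrite ler_pdivlMr ?ltr_pwDr // => h; apply: le_trans h.
by rewrite mulrC ler_wpM2l ?bn_ge0 // lerDl.
Unshelve. all: by end_near. Qed.

HB.instance Definition _ := GRing.isSubmodClosed.Build R (nat -> R)
  convergent_series convergent_series_submod.

Record basis_space := BasisSpace {
  bs_val :> nat -> R; bs_valP : bs_val \in convergent_series }.

HB.instance Definition _ := [isSub for bs_val].
HB.instance Definition _ := [Choice of basis_space by <:].
HB.instance Definition _ := [SubChoice_isSubLmodule of basis_space by <:].

Implicit Types x y : basis_space.

Lemma basis_space_tail x eps : 0 < eps -> \forall n \near \oo,
  forall m, bn N m (tail n x) <= eps.
Proof. by move=> e0; have /asboolP := bs_valP x; exact. Qed.

Let bs_subE x y i : (x - y) i = x i - y i. Proof. by []. Qed.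

Definition bs_norm x : R := limn (fun n => bn N n x).

Lemma bn_sub_tail n m a : (n <= m)%N ->
  `|bn N m a - bn N n a| <= bn N m (tail n a).
Proof.
move=> nm.
have -> : bn N n a = bn N m (a - tail n a).
  rewrite (@bn_stable _ N n m (a - tail n a) nm) => //; last first.
    move=> i /andP[ni _].
    by rewrite subE /tail ltnNge ni subrr.
  apply: bn_eq => i lin.
  by rewrite subE /tail lin subr0.
by apply: le_trans (bn_dist _ _ _) _; rewrite opprB addrC subrK.
Qed.

Lemma bs_norm_cvg x : (fun n => bn N n x) @ \oo --> bs_norm x.
Proof.
apply/cauchy_cvgP/cauchy_ballP => eps e0.
have /(basis_space_tail x) [n _ nP] : 0 < eps / 3 by rewrite divr_gt0.
have H m : (n <= m)%N -> `|bn N m x - bn N n x| <= eps / 3.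
  by move=> nm; apply: le_trans (bn_sub_tail _ nm) _; exact: (nP n (leqnn n)).
exists ([set r | `|r - bn N n x| <= eps / 3],
        [set r | `|r - bn N n x| <= eps / 3]).
  by split; exists n => // m /= /H.
move=> [r s] /= [hr hs]; rewrite /ball /=.
rewrite -(subrKA (bn N n x)); apply: le_lt_trans (ler_normD _ _) _.
rewrite [X in _ + X]distrC; apply: le_lt_trans (lerD hr hs) _.
by lra.
Qed.

Lemma bn_le_bs_norm n x : bn N n x <= K * bs_norm x.
Proof.
have h : (fun m => K * bn N m x) @ \oo --> K * bs_norm x.
  by apply: cvgMr; exact: bs_norm_cvg.
rewrite -(cvg_lim _ h) //; apply: limr_ge; first by apply/cvg_ex; eexists;
  exact: h.
near=> m; apply: bn_basic; near: m; exact: nbhs_infty_ge.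
Unshelve. all: by end_near. Qed.

Lemma bs_norm_le x M : (forall n, bn N n x <= M) -> bs_norm x <= M.
Proof.
move=> h; apply: limr_le; last by near=> n.
by apply/cvg_ex; exists (bs_norm x); exact: bs_norm_cvg.
Unshelve. all: by end_near. Qed.

Lemma bs_coord_le x i : `|x i| <= (1 + K) * K * bs_norm x.
Proof.
apply: le_trans (bn_coord _ _) _; rewrite -mulrA ler_wpM2l ?bn_le_bs_norm //.
by apply: addr_ge0 => //; apply: le_trans (bn_const_ge1 N).
Qed.

Lemma bs_normD x y : bs_norm (x + y) <= bs_norm x + bs_norm y.
Proof.
have h := cvgD (@bs_norm_cvg x) (@bs_norm_cvg y).
apply: (ler_cvg_to (@bs_norm_cvg (x + y)) (h _)).
by near=> n; exact: bnD.
Unshelve. all: by end_near. Qed.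

Lemma bs_normZ (l : R) x : bs_norm (l *: x) = `|l| * bs_norm x.
Proof.
apply: cvg_lim => //; under eq_fun do rewrite bnZ.
by apply: cvgMr; exact: bs_norm_cvg.
Qed.

Lemma bs_norm0_eq0 x : bs_norm x = 0 -> x = 0.
Proof.
move=> x0; apply: val_inj; apply/funext => i; apply/eqP.
by rewrite -normr_le0; have := bs_coord_le x i; rewrite x0 mulr0.
Qed.

HB.instance Definition _ := Lmodule_isNormed.Build R basis_space
  bs_normD bs_normZ bs_norm0_eq0.

Lemma bs_normE x : `|x| = bs_norm x. Proof. by []. Qed.

(** Coordinates are Lipschitz, so a Cauchy filter has a coordinatewise limit [a]. It is approached
    in all the norms [bn N n] uniformly in [n], hence has small tails and is the limit in norm. *)
Lemma bs_complete (F : set_system basis_space) :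
  ProperFilter F -> cauchy F -> cvg F.
Proof.
move=> FF /cauchy_ballP Fc.
have K0 : 0 < K by apply: lt_le_trans (bn_const_ge1 N).
have C0 : 0 < (1 + K) * K by rewrite mulr_gt0 // addr_gt0.
have coordc i : cvg ((fun x : basis_space => x i) @ F).
  apply/cauchy_cvgP/cauchy_ballP => eps e0.
  have d0 : 0 < eps / ((1 + K) * K) by rewrite divr_gt0.
  have := Fc _ d0; case=> -[A B] /= [FA FB] AB.
  exists ([set y i | y in A], [set y i | y in B]).
    by split; [apply: filterS FA => y Ay | apply: filterS FB => y By];
      exists y.
  move=> [_ _] /= [[y Ay <-] [z Bz <-]]; rewrite /ball /=.
  have : `|y - z| < eps / ((1 + K) * K) by apply: (AB (y, z)).
  rewrite ltr_pdivlMr // mulrC; apply: le_lt_trans.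
  exact: (bs_coord_le (y - z)).
pose a i := lim ((fun x : basis_space => x i) @ F).
have bncvg n eps : 0 < eps ->
    \forall y \near F, bn N n (bs_val y - a) <= eps.
  move=> e0.
  have H : \forall y \near F, forall i :
    'I_n, `|bs_val y i - a i| <= eps / n.+1%:R.
    apply: filter_forall => i.
    have d0 : 0 < eps / n.+1%:R by rewrite divr_gt0.
    have /cvgrPdist_le /(_ _ d0) := coordc i.
    by apply: filterS => y; rewrite distrC.
  apply: filterS H => y yH; apply: le_trans (bn_le_sum _ _) _.
  apply: (@le_trans _ _ (\sum_(i < n) (eps / n.+1%:R))).
    by apply: ler_sum => i _; exact: yH.
  rewrite sumr_const card_ord -[X in X <= _]mulr_natr mulrAC ler_pdivrMr //.
  by rewrite ler_wpM2l ?ler_nat // ltW.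
have key eps : 0 < eps -> \forall x \near F, forall n, bn N n (bs_val x - a) <=
  eps.
  move=> e0.
  have d0 : 0 < eps / K / 2 by rewrite !divr_gt0.
  have := Fc _ d0; case=> -[A B] /= [FA FB] AB.
  apply: filterS FA => x Ax n; apply/ler_addgt0Pr => e e'0.
  (* The point [y] depends on [n] and [e], but the bound on the norm of [x - y] does not. *)
  near F => y.
  rewrite -(subrKA (bs_val y)); apply: le_trans (bnD _ _ _ _) _.
  have By : B y by near: y.
  have e2 : bn N n (bs_val y - a) <= e by near: y; exact: bncvg.
  apply: lerD => //.
  apply: le_trans (bn_le_bs_norm n (x - y)) _.
  rewrite mulrC -ler_pdivlMr //.
  have /ltW : `|x - y| < eps / K / 2 by apply: (AB (x, y)).
  move/le_trans; apply; rewrite ler_pdivrMr // ler_peMr ?ler1n //.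
  by rewrite divr_ge0 // ltW.
(* A tail of [a] is the sum of a tail of a nearby [x] and a tail of [a - x]. *)
have Pa : a \in convergent_series.
  apply/asboolP => eps e0.
  have d0 : 0 < eps / 2 / (1 + K) by rewrite !divr_gt0 // addr_gt0.
  have [x xP] := filter_ex (key _ d0).
  have h0 : 0 < eps / 2 by rewrite divr_gt0.
  apply: filterS (basis_space_tail x h0) => n nP m.
  have -> : tail n a = tail n x + tail n (a - x) by rewrite -tailD addrC subrK.
  rewrite [leRHS]splitr; apply: le_trans (bnD _ _ _ _) _; apply: lerD => //.
  apply: le_trans (bn_tail _ _ _) _.
  rewrite mulrC -ler_pdivlMr ?addr_gt0 // -bnN opprB; exact: xP.
apply/cvg_ex; exists (BasisSpace Pa); apply/cvgrPdist_le => /= eps e0.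
apply: filterS (key _ e0) => x xP.
rewrite distrC; apply: bs_norm_le => n; exact: xP.
Unshelve. all: by end_near. Qed.

HB.instance Definition _ := Uniform_isComplete.Build basis_space bs_complete.

Lemma unit_convergent i :
  (fun k => (k == i)%:R : R) \in convergent_series.
Proof.
apply/asboolP => eps e0; near=> n => m.
rewrite (_ : tail _ _ = 0) ?bn0 1?ltW //; apply/funext => k; rewrite /tail.
case: ltnP => // nk; rewrite gtn_eqF //; apply: leq_trans nk.
by near: n; exact: nbhs_infty_gt.
Unshelve. all: by end_near. Qed.

Definition bs_unit i : basis_space := BasisSpace (unit_convergent i).

Lemma bs_sumE n (a : nat -> R) k :
  (\sum_(i < n) a i *: bs_unit i) k = if (k < n)%N then a k else 0.
Proof.
elim: n => [|n IH]; first by rewrite big_ord0.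
rewrite big_ord_recr /= addE IH scaleE [(k < n.+1)%N]ltnS [(k <= n)%N]leq_eqVlt.
by have [->|] := eqVneq k n; rewrite ?ltnn /= ?add0r ?mulr1 ?mulr0 ?addr0.
Qed.

Lemma bs_norm_sum n (a : nat -> R) :
  `|\sum_(i < n) a i *: bs_unit i| = bn N n a.
Proof.
rewrite bs_normE; apply: cvg_lim => //.
apply: cvg_near_cst; near=> m.
rewrite (@bn_stable _ N n m) => [||i /andP[ni _]].
- by apply: bn_eq => i ni; rewrite bs_sumE ni.
- by near: m; exact: nbhs_infty_ge.
- by rewrite bs_sumE ltnNge ni.
Unshelve. all: by end_near. Qed.

Lemma bs_unit_normalized : normalized bs_unit.
Proof.
move=> i; have := bs_norm_sum i.+1 (fun k => (k == i)%:R).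
rewrite bn_unit big_ord_recr /= eqxx scale1r big1 ?add0r // => k _.
by rewrite ltn_eqF ?ltn_ord // scale0r.
Qed.

(** The error of a partial sum of [x] is a tail of [x]; uniqueness holds because the coordinates are
    continuous. *)
Lemma bs_schauder : schauder_basis bs_unit.
Proof.
move=> x; exists (x : nat -> R); split.
  apply/cvgrPdist_le => /= eps e0.
  apply: filterS (basis_space_tail x e0) => n nP.
  apply: bs_norm_le => m; apply: le_trans (nP m); rewrite le_eqVlt.
  apply/orP; left; apply/eqP/bn_eq => i _.
  rewrite bs_subE bs_sumE /tail.
  by case: ifP; rewrite ?subrr ?subr0.
move=> a /cvgrPdist_le /= ha; apply/funext => i.
apply/eqP; rewrite -subr_eq0 -normr_le0; apply/ler_addgt0Pr => eps e0.
have K0 : 0 < K by apply: lt_le_trans (bn_const_ge1 N).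
have C0 : 0 < (1 + K) * K by rewrite mulr_gt0 // addr_gt0.
have d0 : 0 < eps / ((1 + K) * K) by rewrite divr_gt0.
near \oo => n.
have : `|x - \sum_(i < n) a i *: bs_unit i| <= eps / ((1 + K) * K).
  by near: n; exact: ha.
rewrite ler_pdivlMr // mulrC add0r; apply: le_trans.
have := bs_coord_le (x - \sum_(i < n) a i *: bs_unit i) i.
rewrite bs_subE bs_sumE ifT //.
by near: n; exact: nbhs_infty_gt.
Unshelve. all: by end_near. Qed.

End BasisSpace.

(** * Iterated limits along an ultrafilter *)

(** The net is a grid of mesh [eta] starting at [- B]; each coordinate is rounded down to it. *)
Lemma cube_net (R : realType) (B eta : R) (n : nat) : 0 < eta ->
  exists (I : finType) (g : I -> nat -> R), forall a : nat -> R,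
    (forall j, (j < n)%N -> `|a j| <= B) ->
    exists i, forall j, (j < n)%N -> `|a j - g i j| <= eta.
Proof.
move=> eta0; pose M := Num.truncn (2 * B / eta).
pose g (f : {ffun 'I_n -> 'I_M.+1}) j : R :=
  if insub j is Some k then - B + eta * (f k)%:R else 0.
exists {ffun 'I_n -> 'I_M.+1}, g => a aB.
exists [ffun k : 'I_n => inord (Num.truncn ((a k + B) / eta))] => j jn.
rewrite /g insubT ffunE /=.
have := aB _ jn; rewrite ler_norml => /andP[a1 a2].
have u0 : 0 <= (a j + B) / eta by rewrite divr_ge0 ?(ltW eta0) //; lra.
rewrite inordK; last first.
  rewrite ltnS; apply: le_truncn.
  by rewrite ler_pM2r ?invr_gt0 //; lra.
have /andP[] := truncn_itv u0.
set k := Num.truncn _; rewrite ler_pdivlMr // ltr_pdivrMr // => k1 k2.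
rewrite ler_norml; apply/andP; split; first by lra.
by move: k2; rewrite -natr1 mulrDl mul1r; lra.
Qed.

Section UltraLimit.
Variables (R : realType) (U : set_system nat).
Hypothesis UU : UltraFilter U.

Definition ulim (h : nat -> R) : R := lim (h @ U).

(** By compactness of the segment the image ultrafilter has a cluster point, and an ultrafilter
    converges to its cluster points. *)
Lemma ulim_cvg (h : nat -> R) (M : R) :
  (forall i, `|h i| <= M) -> h @ U --> ulim h.
Proof.
move=> hM; suff : cvg (h @ U) by [].
have [|l [_ hl]] := @segment_compact R (- M) M (h @ U).
  suff : U (h @^-1` `[- M, M]) by [].
  by apply: filterE => i; rewrite /= in_itv /=; have := hM i; rewrite ler_norml.
apply/cvg_ex; exists l => V lV.
have [//|nV] := in_ultra_setVsetC (h @^-1` V) UU.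
by have [r []] := hl (~` V) V nV lV.
Qed.

Lemma ulim_le (h : nat -> R) (M c : R) :
  (forall i, `|h i| <= M) -> (forall i, `|h i| <= c) -> `|ulim h| <= c.
Proof.
move=> hM hc; have h1 := cvg_norm (ulim_cvg hM).
apply: (ler_cvg_to (h1 _) (cvg_cst c)); exact: nearW.
Qed.

Lemma ulim_dist (h g : nat -> R) (M c : R) :
  (forall i, `|h i| <= M) -> (forall i, `|g i| <= M) ->
  (forall i, `|h i - g i| <= c) -> `|ulim h - ulim g| <= c.
Proof.
move=> hM gM hg; have h1 := cvg_norm (cvgB (ulim_cvg hM) (ulim_cvg gM)).
apply: (ler_cvg_to (h1 _ _) (cvg_cst c)); exact: nearW.
Qed.

(** Pointwise convergence of equi-Lipschitz functions is uniform on a cube: it is tested on a finite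
    net, and each of the three errors is at most [eps / 3]. *)
Lemma ultra_uniform (n : nat) (h : nat -> (nat -> R) -> R)
    (g : (nat -> R) -> R) (B eps : R) :
  (forall i a b, `|h i a - h i b| <= \sum_(j < n) `|a j - b j|) ->
  (forall a b, `|g a - g b| <= \sum_(j < n) `|a j - b j|) ->
  (forall a, (h ^~ a) @ U --> g a) -> 0 < eps ->
  \forall i \near U, forall a, (forall j, (j < n)%N -> `|a j| <= B) ->
    `|h i a - g a| <= eps.
Proof.
move=> hL gL hg e0.
have d0 : 0 < eps / 3 / n.+1%:R by rewrite !divr_gt0.
have [I [f If]] := cube_net B n d0.
have N : \forall i \near U, forall k : I, `|h i (f k) - g (f k)| <= eps / 3.
  apply: filter_forall => k.
  have e3 : 0 < eps / 3 by rewrite divr_gt0.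
  have /cvgrPdist_le /(_ _ e3) := hg (f k).
  by apply: filterS => i; rewrite distrC.
apply: filterS N => i Hi a aB.
have [k kP] := If a aB.
have S : \sum_(j < n) `|a j - f k j| <= eps / 3.
  apply: (@le_trans _ _ (\sum_(j < n) (eps / 3 / n.+1%:R))).
    by apply: ler_sum => j _; exact: kP.
  rewrite sumr_const card_ord -[X in X <= _]mulr_natr mulrAC ler_pdivrMr //.
  by rewrite ler_wpM2l ?ler_nat // ltW // divr_gt0.
have h1 := le_trans (hL i a (f k)) S.
have h2 := le_trans (gL a (f k)) S; have h3 := Hi k.
have -> : h i a - g a =
  (h i a - h i (f k)) + ((h i (f k) - g (f k)) - (g a - g (f k))).
  by ring.
apply: le_trans (ler_normD _ _) _.
have := ler_normB (h i (f k) - g (f k)) (g a - g (f k)).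
by lra.
Qed.

End UltraLimit.

Section IteratedLimit.
Variables (R : realType) (X : completeNormedModType R).
Variables (U : set_system nat) (y : nat -> nat -> X).
Hypothesis UU : UltraFilter U.
Hypothesis y1 : forall k i, `|y k i| = 1.
Implicit Types (a b : nat -> R) (z : X).

(** The iterated limit over [i_j], then [i_(j+1)], up to [i_(j+r-1)], with [i_j] outermost, of the
    norm of [z] plus the sum of the [a k *: y k i_k]. *)
Fixpoint iter_lim (r j : nat) z a : R :=
  if r is r'.+1 then ulim U (fun i => iter_lim r' j.+1 (z + a j *: y j i) a)
  else `|z|.

Let sum_shift (F : nat -> R) r j :
  \sum_(k < r.+1) F (j + k)%N = F j + \sum_(k < r) F (j.+1 + k)%N.
Proof.
rewrite big_ord_recl addn0; congr (_ + _).
by apply: eq_bigr => k _; rewrite /= /bump /= add1n addSnnS.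
Qed.

Lemma iter_lim_bound r j z a :
  `|iter_lim r j z a| <= `|z| + \sum_(k < r) `|a (j + k)%N|.
Proof.
elim: r j z => [|r IH] j z; first by rewrite big_ord0 addr0 normr_id.
suff H i : `|iter_lim r j.+1 (z + a j *: y j i) a| <=
    `|z| + \sum_(k < r.+1) `|a (j + k)%N|.
  by apply: (ulim_le UU H H).
apply: le_trans (IH _ _) _.
rewrite (sum_shift (fun k => `|a k|)) addrA lerD2r.
by apply: le_trans (ler_normD _ _) _; rewrite normrZ y1 mulr1.
Qed.

Let iter_lim_bounded r j z a :
  exists M : R, forall i, `|iter_lim r j.+1 (z + a j *: y j i) a| <= M.
Proof.
exists (`|z| + `|a j| + \sum_(k < r) `|a (j.+1 + k)%N|) => i.
apply: le_trans (iter_lim_bound _ _ _ _) _; rewrite lerD2r.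
by apply: le_trans (ler_normD _ _) _; rewrite normrZ y1 mulr1.
Qed.

Lemma iter_lim_cvg r j z a :
  (fun i => iter_lim r j.+1 (z + a j *: y j i) a) @ U --> iter_lim r.+1 j z a.
Proof. by have [M MP] := iter_lim_bounded r j z a; exact: (ulim_cvg UU MP). Qed.

Lemma iter_lim_lipschitz r j z z' a b :
  `|iter_lim r j z a - iter_lim r j z' b| <=
    `|z - z'| + \sum_(k < r) `|a (j + k)%N - b (j + k)%N|.
Proof.
elim: r j z z' => [|r IH] j z z'.
  by rewrite big_ord0 addr0; exact: ler_dist_dist.
have [M MP] := iter_lim_bounded r j z a.
have [M' M'P] := iter_lim_bounded r j z' b.
apply: (@ulim_dist _ _ UU _ _ (Num.max M M')) => i.
- by rewrite le_max MP.
- by rewrite le_max M'P orbT.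
apply: le_trans (IH _ _ _) _.
rewrite (sum_shift (fun k => `|a k - b k|)) addrA lerD2r.
rewrite opprD addrACA; apply: le_trans (ler_normD _ _) _.
by rewrite -scalerBl normrZ y1 mulr1.
Qed.

(** The innermost limit is taken of a constant. *)
Lemma iter_lim_zero r j z a : a (j + r)%N = 0 ->
  iter_lim r.+1 j z a = iter_lim r j z a.
Proof.
elim: r j z => [|r IH] j z a0 /=.
  rewrite addn0 in a0; rewrite a0.
  under eq_fun do rewrite scale0r addr0.
  by rewrite /ulim lim_cst.
rewrite -addSnnS in a0; congr (ulim _ _); apply/funext => i.
by rewrite -[RHS]IH.
Qed.

(** Here [h] lists the [s] indices chosen so far. Using [i] for row [r] must nearly realize the
    limit over that row, after any choice [c] of old indices for the rows before it and with [q]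
    limits still to come. These are finitely many conditions, each true along [U]. *)
Lemma selection_step (Q : nat -> nat -> nat) (s : nat) (h : nat -> nat) :
  (forall i, U [set k | (i <= k)%N]) ->
  \forall i \near U, (forall t, (t < s)%N -> (Q t (h t) < i)%N) /\
    forall (r q : 'I_s.+2) (c : {ffun 'I_r -> 'I_s}) a,
      (forall j, (j < r.+1 + q)%N -> `|a j| <= 1) ->
      let z := \sum_(j < r) a j *: y j (h (c j)) in
      `|iter_lim q r.+1 (z + a r *: y r i) a - iter_lim q.+1 r z a|
        <= (s.+2%:R ^+ 2)^-1.
Proof.
move=> Uoo; apply: filterI.
  have H : \forall i \near U, forall t : 'I_s, (Q t (h t) < i)%N.
    by apply: filter_forall => t; exact: Uoo.
  by apply: filterS H => i iP t ts; exact: (iP (Ordinal ts)).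
apply: filter_forall => r; apply: filter_forall => q; apply: filter_forall => c.
have lipz a b : `|\sum_(j < r) a j *: y j (h (c j)) - \sum_(j < r) b j *:
  y j (h (c j))|
    <= \sum_(j < r) `|a j - b j|.
  rewrite -sumrB; apply: le_trans (ler_norm_sum _ _ _) _.
  by apply: ler_sum => j _; rewrite -scalerBl normrZ y1 mulr1.
apply: (@ultra_uniform R U UU (r.+1 + q)
  (fun i a => iter_lim q r.+1 (\sum_(j < r) a j *: y j (h (c j)) + a r *:
    y r i) a)
  (fun a => iter_lim q.+1 r (\sum_(j < r) a j *: y j (h (c j))) a)).
- move=> i a b; apply: le_trans (iter_lim_lipschitz _ _ _ _ _ _) _.
  rewrite big_split_ord /= lerD2r big_ord_recr /=.
  rewrite opprD addrACA; apply: le_trans (ler_normD _ _) _.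
  by rewrite -scalerBl normrZ y1 mulr1 lerD2r.
- move=> a b; apply: le_trans (iter_lim_lipschitz _ _ _ _ _ _) _.
  rewrite addSnnS big_split_ord /=.
  by rewrite lerD2r.
- by move=> a; exact: iter_lim_cvg.
- by rewrite invr_gt0 exprn_gt0.
Qed.

Arguments iter_lim : simpl never.

(* Column [s] is chosen with an error [(s + 2)^-2]; in an admissible choice of
   [n] columns, each of them costs at most [(n + 1)^-2]. *)
Lemma selection (Q : nat -> nat -> nat) :
  (forall i, U [set k | (i <= k)%N]) ->
  exists phi : nat -> nat,
    (forall t s, (t < s)%N -> (Q t (phi t) < phi s)%N) /\
    forall n (c : nat -> nat) (a : nat -> R), admissible n c ->
      (forall j, (j < n)%N -> `|a j| <= 1) ->
      `| `|\sum_(j < n) a j *: y j (phi (c j))| - iter_lim n 0 0 a|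
        < harmonic n.
Proof.
move=> Uoo.
pose P (h : seq nat) (i : nat) :=
  (forall t, (t < size h)%N -> (Q t (nth 0%N h t) < i)%N) /\
    forall (r q : 'I_(size h).+2) (c : {ffun 'I_r -> 'I_(size h)}) a,
      (forall j, (j < r.+1 + q)%N -> `|a j| <= 1) ->
      let z := \sum_(j < r) a j *: y j (nth 0%N h (c j)) in
      `|iter_lim q r.+1 (z + a r *: y r i) a - iter_lim q.+1 r z a|
        <= ((size h).+2%:R ^+ 2)^-1.
have /choice [pick pickP] h : exists i, P h i.
  have [i Pi] := filter_ex (@selection_step Q (size h) (nth 0%N h) Uoo).
  by exists i.
pose hist s := iter s (fun h => rcons h (pick h)) [::].
pose phi s := pick (hist s).
have size_hist s : size (hist s) = s by elim: s => //= s IH;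
  rewrite size_rcons IH.
have nth_hist t s : (t < s)%N -> nth 0%N (hist s) t = phi t.
  elim: s => // s IH; rewrite ltnS leq_eqVlt nth_rcons size_hist.
  by case/predU1P => [->|ts]; [rewrite ltnn eqxx | rewrite ts IH].
exists phi; split=> [t s ts|n c a [nc cinc] a1].
  by have [] := pickP (hist s); rewrite size_hist => /(_ t ts);
    rewrite nth_hist.
pose Z r := \sum_(j < r) a j *: y j (phi (c j)).
have step r : (r < n)%N ->
    `|iter_lim (n - r.+1) r.+1 (Z r.+1) a - iter_lim (n - r) r (Z r) a|
      <= (n.+1%:R ^+ 2)^-1.
  move=> rn; have ncr := nc _ rn.
  (* Admissibility gives [n <= (c r).+1]: this puts [r] and [n - r.+1] in the range covered when
     column [c r] was chosen, and bounds its error by [(n + 1)^-2]. *)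
  have [_] := pickP (hist (c r)); rewrite size_hist => H.
  have r1 : (r < (c r).+2)%N by lia.
  have q1 : (n - r.+1 < (c r).+2)%N by lia.
  have cc (j : 'I_r) : (c j < c r)%N by apply: cinc; rewrite ltn_ord.
  have := H (Ordinal r1) (Ordinal q1) [ffun j => Ordinal (cc j)] a.
  rewrite /= -subSn // subSS.
  have -> : \sum_(j < r) a j *: y j (nth 0%N (hist (c r))
      ([ffun j => Ordinal (cc j)] j)) = Z r.
    by apply: eq_bigr => j _; rewrite ffunE nth_hist.
  rewrite -[pick (hist (c r))]/(phi (c r)).
  have -> : Z r + a r *: y r (phi (c r)) = Z r.+1 by rewrite /Z big_ord_recr.
  move=> /(_ _)/le_trans; apply; first by move=> j jn; apply: a1; lia.
  rewrite lef_pV2 ?posrE ?exprn_gt0 // lerXn2r ?nnegrE //.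
  by rewrite ler_nat; lia.
have tele r : (r <= n)%N -> `|iter_lim (n - r) r (Z r) a - iter_lim n 0 0 a|
      <= r%:R / n.+1%:R ^+ 2.
  elim: r => [_|r IH rn].
    by rewrite subn0 /Z big_ord0 subrr normr0 mul0r.
  rewrite -(subrKA (iter_lim (n - r) r (Z r) a)).
  apply: le_trans (ler_normD _ _) _;
    apply: le_trans (lerD (step _ rn) (IH (ltnW rn))) _.
  by rewrite -[r.+1%:R]natr1 mulrDl mul1r addrC.
have := tele n (leqnn n);
  rewrite subnn -[iter_lim 0 _ _ _]/(`|_|) => /le_lt_trans; apply.
rewrite /harmonic /= ltr_pdivrMr ?exprn_gt0 // expr2 mulKf ?pnatr_eq0 //.
by rewrite ltr_nat.
Qed.

End IteratedLimit.

(** * Realizing the limit norm of an array by a Banach space with a basis *)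

Section AsymptoticModel.
Variables (R : realType) (X : completeNormedModType R).
Variables (K : R) (x : nat -> nat -> X) (H : nat -> (nat -> R) -> R).
Hypothesis x_basic : basic_array K x.
Hypothesis H_eq : forall n a b, (forall j, (j < n)%N -> a j = b j) -> H n a =
  H n b.
Hypothesis H_zero : forall n a, a n = 0 -> H n.+1 a = H n a.
Hypothesis H_lim : forall n (c : nat -> nat) (a : nat -> R), admissible n c ->
  (forall j, (j < n)%N -> `|a j| <= 1) ->
  `| `|\sum_(j < n) a j *: x j (c j)| - H n a| < harmonic n.

(** The columns [s, s + 1, ...] are an admissible choice as soon as [n <= s]. *)
Let diag n (a : nat -> R) s : R := `|\sum_(j < n) a j *: x j (s + j)%N|.

Let trunc n (a : nat -> R) : nat -> R := fun j => if (j < n)%N then a j else 0.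

Let H_trunc n m a : (n <= m)%N -> H m (trunc n a) = H n a.
Proof.
move=> nm; rewrite -(subnKC nm); elim: (m - n)%N => [|k IH].
  by rewrite addn0; apply: H_eq => j jn; rewrite /trunc jn.
by rewrite addnS H_zero // /trunc ltnNge leq_addr.
Qed.

Let diag_trunc n m a s : (n <= m)%N -> diag m (trunc n a) s = diag n a s.
Proof.
move=> nm; rewrite -(subnKC nm) /diag big_split_ord /= [X in _ + X]big1 ?addr0.
  by congr (`| _ |); apply: eq_bigr => j _; rewrite /trunc ltn_ord.
by move=> j _; rewrite /trunc ltnNge leq_addr scale0r.
Qed.

Let shift_admissible n s : (n <= s)%N -> admissible n (addn s).
Proof.
by move=> ns; split=> [j _|j k /andP[jk _]]; rewrite ?ltn_add2l //; lia.
Qed.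

Let diag_cvg_le1 n a : (forall j, (j < n)%N -> `|a j| <= 1) ->
  diag n a @ \oo --> H n a.
Proof.
move=> a1; apply/cvgrPdist_lt => eps e0.
(* At length [n] the error is only known to be below [harmonic n]; padding with zeros to length
   [maxn n m] brings it below [eps]. *)
have /cvgr0_norm_lt /(_ _ e0) [m _ mP] := @cvg_harmonic R.
have hm : `|@harmonic R (maxn n m)| < eps by apply: mP; exact: leq_maxr.
near=> s.
have ms : (maxn n m <= s)%N by near: s; exact: nbhs_infty_ge.
rewrite -(diag_trunc _ _ (leq_maxl n m)) -(H_trunc _ (leq_maxl n m)) distrC.
apply: lt_trans (lt_le_trans _ (ler_norm _)) hm.
apply: H_lim; first exact: shift_admissible.
move=> j _; rewrite /trunc; case: ifP => [|_]; first exact: a1.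
by rewrite normr0.
Unshelve. all: by end_near. Qed.

Let diagZ n l a s : diag n (l *: a) s = `|l| * diag n a s.
Proof.
rewrite /diag -normrZ scaler_sumr; congr (`| _ |).
by apply: eq_bigr => j _; rewrite scalerA.
Qed.

Let diag_cvg n a : cvg (diag n a @ \oo).
Proof.
pose l := 1 + \sum_(j < n) `|a j|.
have l0 : 0 < l by rewrite ltr_pwDl // sumr_ge0.
have -> : diag n a = fun s => l * diag n (l^-1 *: a) s.
  by apply/funext => s;
    rewrite -[X in X * _](gtr0_norm l0) -diagZ scalerA mulfV ?gt_eqF // scale1r.
apply: is_cvgMr; apply/cvg_ex; eexists; apply: diag_cvg_le1 => j jn.
rewrite -[(l^-1 *: a) j]/(l^-1 * a j) normrM normfV (gtr0_norm l0) mulrC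
  ler_pdivrMr // mul1r.
by rewrite /l (bigD1 (Ordinal jn)) //= addrCA lerDl addr_ge0 // sumr_ge0.
Qed.

(** [H] is tied to the norm only for coefficients of modulus at most 1. The limit along diagonals
    exists for all [a], inherits the norm axioms and the constant [K], and agrees with [H] on such
    coefficients. *)
Let N n a : R := limn (diag n a).

Let N_le n m a b (C : R) :
  (\forall s \near \oo, diag n a s <= C * diag m b s) ->
  N n a <= C * N m b.
Proof.
move=> h; have h2 : C * diag m b s @[s --> \oo] --> C * N m b.
  by apply: cvgMr; exact: diag_cvg.
by apply: (ler_cvg_to (diag_cvg (n := n) (a := a)) h2).
Qed.

Let N_unit i : N i.+1 (fun k => (k == i)%:R) = 1.
Proof.
rewrite /N (_ : diag _ _ = cst 1) ?lim_cst //; apply/funext => s.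
rewrite /diag big_ord_recr /= eqxx scale1r big1 ?add0r => [|k _].
  by have [] := x_basic.1 i.
by rewrite ltn_eqF ?ltn_ord // scale0r.
Qed.

Definition asymptotic_norm : basis_norm R.
Proof.
refine (@BasisNorm _ N K _ _ _ _ _ _ N_unit).
- move=> n a b.
  have h2 : diag n a s + diag n b s @[s --> \oo] --> N n a + N n b.
    by apply: cvgD; exact: diag_cvg.
  apply: (ler_cvg_to (diag_cvg (n := n) (a := a + b)) h2).
  apply: nearW => s; rewrite /diag.
  under eq_bigr do rewrite scalerDl.
  by rewrite big_split /=; exact: ler_normD.
- move=> n l a; apply: cvg_lim => //.
  have -> : diag n (l *: a) = fun s => `|l| * diag n a s.
    by apply/funext => s; exact: diagZ.
  by apply: cvgMr; exact: diag_cvg.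
- move=> n a b ab; congr (limn _); apply/funext => s; congr (`| _ |).
  by apply: eq_bigr => j _; rewrite ab.
- move=> n m a nm a0; congr (limn _); apply/funext => s.
  rewrite -(diag_trunc _ _ nm); congr (`| _ |).
  apply: eq_bigr => j _; rewrite /trunc; case: ltnP => // nj.
  by rewrite a0 ?nj ?ltn_ord.
- by have [_ []] := x_basic.1 0%N.
- move=> n m a nm; apply: N_le; near=> s.
  have ms : (m <= s)%N by near: s; exact: nbhs_infty_ge.
  have [_ _] := x_basic.2 m _ (shift_admissible ms).
  by apply; rewrite nm /=.
Unshelve. all: by end_near. Defined.

Lemma asymptotic_model_exists : asymptotic_model x (bs_unit asymptotic_norm).
Proof.
split; [by exists K | exact: bs_unit_normalized | exact: bs_schauder |].
exists harmonic; split.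
- by move=> n; exact: harmonic_gt0.
- move=> n m nm; rewrite /harmonic /= lef_pV2 ?posrE //.
  by rewrite ler_nat ltnS.
- exact: cvg_harmonic.
- move=> n i a ai a1; rewrite bs_norm_sum.
  have -> : bn asymptotic_norm n a = H n a.
    by apply: cvg_lim => //; exact: diag_cvg_le1.
  exact: H_lim.
Qed.

End AsymptoticModel.

(** * Block sequences *)

Lemma infinite_natP (A : set nat) :
  infinite_set A <-> forall n, exists l, (n <= l)%N /\ A l.
Proof.
split=> [Ainf n|AP /finite_seqP [s sA]].
  apply: contrapT => H; apply: Ainf.
  apply: (sub_finite_set _ (finite_II n)) => l Al /=.
  by rewrite ltnNge; apply/negP => nl; apply: H; exists l.
have [l []] := AP (\max_(i <- s) i).+1.
rewrite sA /= ltnNge => /negP + ls; apply.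
exact: (leq_bigmax_seq _ ls).
Qed.

Section Blocks.
Variables (R : realType) (X : completeNormedModType R).
Implicit Types (e x : nat -> X) (a : nat -> R).

(** A partial sum of the blocks is a partial sum over [e] cut at a boundary [L k], so the constant
    [K] is inherited. *)
Lemma blocks_K_basic_fin (K : R) e x (N : nat) (L : nat -> nat)
    (c : nat -> nat -> R) :
  K_basic K e -> (forall j, (j < N)%N -> (L j <= L j.+1)%N) ->
  (forall j i, (j < N)%N -> c j i != 0 -> (L j <= i < L j.+1)%N) ->
  (forall j, (j < N)%N -> x j = \sum_(i < L j.+1) c j i *: e i) ->
  (forall j, (j < N)%N -> x j != 0) ->
  K_basic_fin K N x.
Proof.
move=> [K1 _ eK] Lmono csupp xE x0; split=> // a n m /andP[nm mN].
have Lle j k : (j <= k <= N)%N -> (L j <= L k)%N.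
  move=> /andP[jk kN]; elim: k jk kN => [|k IH].
    by rewrite leqn0 => /eqP ->.
  rewrite leq_eqVlt => /predU1P[-> //|]; rewrite ltnS => jk kN.
  exact: leq_trans (IH jk (ltnW kN)) (Lmono _ kN).
(* The coefficients of the full sum over [e]; below [L k] the blocks from [k] on contribute nothing
   to them. *)
pose b i := \sum_(j < m) a j * c j i.
have sumE k : (k <= m)%N -> \sum_(j < k) a j *: x j = \sum_(i < L k) b i *: e i.
  move=> km; under [RHS]eq_bigr do rewrite /b scaler_suml.
  rewrite exchange_big /= -(big_mkord xpredT (fun j => a j *: x j)).
  rewrite -(big_mkord xpredT
    (fun j => \sum_(i < L k) (a j * c j i) *: e i)).
  rewrite (big_cat_nat (leq0n k) km) /= [X in _ + X]big_nat [X in _ + X]big1;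
    last first.
    move=> j /andP[kj jm]; apply: big1 => i _.
    have jN : (j < N)%N := leq_trans jm mN.
    have [->|/(csupp _ _ jN)] := eqVneq (c j i) 0;
      first by rewrite mulr0 scale0r.
    have := Lle k j; rewrite kj (ltnW jN) => /(_ isT) Lkj.
    by move=> /andP[/(leq_trans Lkj)]; rewrite leqNgt ltn_ord.
  rewrite addr0 !big_nat; apply: eq_bigr => j /andP[_ jk].
  have jN : (j < N)%N := leq_trans jk (leq_trans km mN).
  rewrite xE // scaler_sumr.
  have Ljk : (L j.+1 <= L k)%N by apply: Lle; rewrite jk (leq_trans km mN).
  rewrite (big_ord_widen _ (fun i => a j *: (c j i *: e i)) Ljk) big_mkcond /=.
  apply: eq_bigr => i _; rewrite scalerA; case: ltnP => // Li.
  have [->|/(csupp _ _ jN)] := eqVneq (c j i) 0; first by rewrite mulr0 scale0r.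
  by rewrite ltnNge Li andbF.
rewrite !sumE //; apply: eK; apply: Lle; rewrite nm //.
Qed.

Lemma K_basic_of_fin (K : R) x : (forall N, K_basic_fin K N x) -> K_basic K x.
Proof.
move=> H; split.
- by have [] := H 0%N.
- by move=> i; have [_ + _] := H i.+1; apply.
- by move=> a n m nm; have [_ _] := H m; apply; rewrite nm /=.
Qed.

Lemma subsequence_K_basic_fin (K : R) e (N : nat) (p : nat -> nat) :
  K_basic K e -> (forall j k, (j < k < N)%N -> (p j < p k)%N) ->
  K_basic_fin K N (fun j => e (p j)).
Proof.
move=> eK pN; have [_ e0 _] := eK.
(* Block [j] occupies the window from [p (j - 1) + 1] to [p j]; the first window starts at 0. *)
apply: (@blocks_K_basic_fin K e _ N (fun j =>
  if j is k.+1 then (p k).+1 else 0%N)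
  (fun j i => (i == p j)%:R)) => //.
- by move=> [|j] //= jN; rewrite ltnS ltnW // pN // ltnSn.
- move=> j i jN; have [->|] := eqVneq i (p j); last by rewrite eqxx.
  by case: j jN => [|j] jN _; rewrite ltnSn ?andbT //= pN // ltnSn.
- move=> j jN; rewrite big_ord_recr /= eqxx scale1r big1 ?add0r // => i _.
  by rewrite ltn_eqF ?ltn_ord // scale0r.
Qed.

Lemma subsequence_block_basis e (p : nat -> nat) :
  (forall i, e i != 0) -> (forall j k, (j < k)%N -> (p j < p k)%N) ->
  block_basis e (fun j => e (p j)).
Proof.
move=> e0 pinc; split=> // ;
  exists (fun j => (p j).+1), (fun j i => (i == p j)%:R).
split=> [j i ij|j|j i k].
- by rewrite gtn_eqF.
- rewrite big_ord_recr /= eqxx scale1r big1 ?add0r // => i _.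
  by rewrite ltn_eqF ?ltn_ord // scale0r.
- have [->|] := eqVneq i (p j); last by rewrite eqxx.
  have [->|] := eqVneq k (p j.+1); last by rewrite eqxx.
  by move=> _ _; apply: pinc.
Qed.

Lemma block_asymptotic_model (w : nat -> X) (B : nat -> set nat) :
  normalized w -> basic w -> (forall k, infinite_set (B k)) ->
  exists (V : completeNormedModType R) (x : nat -> nat -> X) (v : nat -> V),
    [/\ forall j, normalized (x j) /\ block_basis w (x j), asymptotic_model x v
      &
     forall k s, (k <= s)%N -> exists l, [/\ (s <= l)%N, B k l & x k s = w l]].
Proof.
move=> w1 [K wK] Binf.
have [U [UU FU]] : exists U, UltraFilter U /\ (\oo : set_system nat) `<=` U.
  exact: ultraFilterLemma.
have Uoo i : U [set k | (i <= k)%N] by apply: FU; exists i.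
have /choice [b bP] (ki : nat * nat) : exists l, (ki.2 <= l)%N /\ B ki.1 l.
  exact: (infinite_natP _).1 (Binf ki.1) ki.2.
pose y k i := w (b (k, i)).
(* A bound for every position used by column [t], once its index is [i]; later columns lie strictly
   beyond it. *)
pose Q t i := maxn i (\max_(k < t.+1) b (val k, i)).
have [phi [phiQ phiP]] := selection UU (fun k i => w1 (b (k, i))) Q Uoo.
have phi_lt t s : (t < s)%N -> (phi t < phi s)%N.
  by move=> ts; apply: leq_ltn_trans (phiQ _ _ ts); exact: leq_maxl.
have phi_ge s : (s <= phi s)%N.
  by elim: s => // s IH; apply: leq_ltn_trans IH (phi_lt _ _ (ltnSn s)).
(* [Q] controls finitely many rows, so row [k > s] gets the default position [phi s]. An admissible
   choice has [j <= i j] and never meets a default entry. *)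
pose p k s := if (k <= s)%N then b (k, phi s) else phi s.
have p_ge k s : (phi s <= p k s)%N.
  by rewrite /p; case: ifP => // _; have [] := bP (k, phi s).
have p_lt k s s' : (s < s')%N -> (p k s < phi s')%N.
  move=> ss'; apply: leq_ltn_trans (phiQ _ _ ss'); rewrite /p /Q.
  case: ifP => [ks|_]; last exact: leq_maxl.
  apply: leq_trans (leq_maxr _ _); rewrite -ltnS in ks.
  exact: (leq_bigmax (Ordinal ks)).
have p_inc k k' s s' : (s < s')%N -> (p k s < p k' s')%N.
  by move=> ss'; apply: leq_trans (p_lt k _ _ ss') (p_ge k' s').
have w0 i : w i != 0 by rewrite -normr_gt0 w1.
have xB : basic_array K (fun k s => w (p k s)).
  split=> [j|n i [_ iinc]].
    split=> [i|]; first exact: w1.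
    apply: K_basic_of_fin => N;
      apply: (subsequence_K_basic_fin (p := p j)) => //.
    by move=> s s' /andP[ss' _]; exact: p_inc.
  apply: (subsequence_K_basic_fin (p := fun j => p j (i j))) => //.
  by move=> s s' ss'; apply: p_inc; exact: iinc.
have H_eq n a a' : (forall j, (j < n)%N -> a j = a' j) ->
    iter_lim U y n 0 0 a = iter_lim U y n 0 0 a'.
  move=> aa'; apply/eqP; rewrite -subr_eq0 -normr_le0.
  apply: le_trans (iter_lim_lipschitz UU _ _ _ _ _ _ _) _.
    by move=> k i; exact: w1.
  rewrite subrr normr0 add0r big1 // => j _.
  by rewrite add0n aa' // subrr normr0.
have H_zero n a : a n = 0 -> iter_lim U y n.+1 0 0 a = iter_lim U y n 0 0 a.
  by move=> an; exact: iter_lim_zero.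
have H_lim n (c : nat -> nat) (a : nat -> R) : admissible n c ->
    (forall j, (j < n)%N -> `|a j| <= 1) ->
    `| `|\sum_(j < n) a j *:
      w (p j (c j))| - iter_lim U y n 0 0 a| < harmonic n.
  move=> cn a1; have := phiP n c a cn a1.
  rewrite (_ : \sum_(j < n) a j *: w (b (val j, phi (c j))) =
    \sum_(j < n) a j *: w (p j (c j))) //.
  apply: eq_bigr => j _; rewrite /p ifT //.
  by have [+ _] := cn => /(_ _ (ltn_ord j)); have := ltn_ord j; lia.
exists (basis_space (asymptotic_norm xB H_eq H_zero H_lim)), (fun k s =>
  w (p k s)).
exists (@bs_unit _ (asymptotic_norm xB H_eq H_zero H_lim)); split.
- move=> j; split=> [i|]; first exact: w1.
  by apply: subsequence_block_basis => // s s' ss'; exact: p_inc.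
- exact: asymptotic_model_exists.
- move=> k s ks; exists (b (k, phi s)); have [h1 h2] := bP (k, phi s).
  by split; [exact: leq_trans (phi_ge s) h1 | exact: h2 | rewrite /p ks].
Qed.

End Blocks.

(** * Haar averages *)

Lemma sum_supported (V : nmodType) (G : nat -> V) (p L N : nat) :
  (p + L <= N)%N -> (forall k, ~~ (p <= k < p + L)%N -> G k = 0) ->
  \sum_(k < N) G k = \sum_(j < L) G (p + j)%N.
Proof.
move=> pLN G0; rewrite -(subnKC pLN) -addnA big_split_ord /= big1 ?add0r;
  last first.
  by move=> k _; apply: G0; rewrite negb_and -ltnNge ltn_ord.
rewrite big_split_ord /= [X in _ + X]big1 ?addr0 // => k _.
by apply: G0; rewrite negb_and -leqNgt addnA leq_addr orbT.
Qed.

(** The definition couples precision with length; padding with zero coefficients to length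
    [maxn n N] decouples them. *)
Lemma asymptotically_isometric_near (R : realType) (X V :
  completeNormedModType R)
    (x : nat -> nat -> X) (v : nat -> V) (n : nat) (eps : R) :
  asymptotically_isometric x v -> 0 < eps ->
  exists N, forall (i : nat -> nat) (a : nat -> R),
    (forall j, (j < n)%N -> (N <= (i j).+1)%N) ->
    (forall j k, (j < k < n)%N -> (i j < i k)%N) ->
    (forall j, (j < n)%N -> `|a j| <= 1) ->
    `| `|\sum_(j < n) a j *: x j (i j)| - `|\sum_(j < n) a j *: v j| | < eps.
Proof.
move=> [delta [d0 dmono dlim dP]] e0.
have /cvgr0_norm_lt /(_ _ e0) [N _ NP] := dlim.
exists (maxn n N) => i a iN iinc a1.
have dN : delta (maxn n N) < eps.
  by apply: le_lt_trans (ler_norm _) _; apply: NP; exact: leq_maxr.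
apply: lt_trans dN.
(* The padding indices lie above the sum of all the [i k], hence above each of them. *)
pose i' j := if (j < n)%N then i j else (\sum_(k < n) i k + maxn n N + j)%N.
pose a' j := if (j < n)%N then a j else 0.
have trunc (W : completeNormedModType R) (F : nat -> W) (G : nat -> W) :
    (forall j, (j < n)%N -> F j = G j) ->
    \sum_(j < n) a j *: F j = \sum_(j < maxn n N) a' j *: G j.
  move=> FG; rewrite (@sum_supported _ (fun j => a' j *: G j) 0 n).
  - by apply: eq_bigr => j _; rewrite add0n /a' ltn_ord FG.
  - exact: leq_maxl.
  - by move=> k; rewrite add0n /= /a' => /negbTE ->; rewrite scale0r.
rewrite (trunc _ (fun j => x j (i j)) (fun j => x j (i' j))); last first.
  by move=> j jn; rewrite /i' jn.
rewrite (trunc _ v v) //; apply: dP; last first.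
  move=> j _; rewrite /a'; case: ifP => [|_]; first exact: a1.
  by rewrite normr0.
have ile j : (j < n)%N -> (i j <= \sum_(k < n) i k)%N.
  by move=> jn; rewrite (bigD1 (Ordinal jn)) //= leq_addr.
split=> [j _|j k /andP[jk _]]; rewrite /i'.
  case: ifP => [|_]; first exact: iN.
  by rewrite ltnW // ltnS -addnA addnCA leq_addr.
case: (ltnP k n) => kn; first by rewrite (ltn_trans jk kn) iinc // jk.
case: (ltnP j n) => jn; last by rewrite ltn_add2l.
have := ile _ jn; move: kn jn; clear; lia.
Qed.

Section HaarAverages.
Variables (R : realType) (X : completeNormedModType R).
Variables (e : nat -> X) (A : nat -> nat -> set nat).
Hypothesis e1 : normalized e.

Lemma haar_averages_le1 n : ubound (haar_averages e A n) 1.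
Proof.
move=> r [m [i [_ _ ->]]]; rewrite mulrC ler_pdivrMr ?exprn_gt0 // mul1r.
apply: le_trans (ler_norm_sum _ _ _) _.
under eq_bigr do rewrite e1.
by rewrite sumr_const card_ord natrX.
Qed.

Lemma haar_averages_sub n m : (n <= m)%N ->
  haar_averages e A m `<=` haar_averages e A n.
Proof.
by move=> nm r [k [i [mk iA ->]]]; exists k, i; split=> //; exact: leq_trans mk.
Qed.

Hypothesis avg_nonempty : forall n, haar_averages e A n !=set0.

Lemma sup_haar_averages_nonincreasing :
  nonincreasing_seq (fun n => sup (haar_averages e A n)).
Proof.
move=> n m nm; apply: sup_le.
- by move=> r /(haar_averages_sub nm) rn; exists r => //; exact: lexx.
- exact: avg_nonempty.
- by split; [exact: avg_nonempty | exists 1; exact: haar_averages_le1].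
Qed.

Lemma sup_haar_averages_cvg : cvgn (fun n => sup (haar_averages e A n)).
Proof.
apply: nonincreasing_is_cvgn; first exact: sup_haar_averages_nonincreasing.
exists 0 => _ [n _ <-]; have [r rn] := avg_nonempty n.
apply: le_trans (ub_le_sup _ rn); last by exists 1; exact: haar_averages_le1.
by have [m [i [_ _ ->]]] := rn; rewrite mulr_ge0 // invr_ge0 exprn_ge0.
Qed.

End HaarAverages.

Lemma haar_ell1_plus_of_asymptotic_models (R : realType)
    (X : completeNormedModType R) (e : nat -> X) :
  normalized e -> basic e ->
  (forall (V : completeNormedModType R) (x : nat -> nat -> X) (v : nat -> V),
     (forall j, normalized (x j) /\ block_basis e (x j)) ->
     asymptotic_model x v -> equivalent_to_ell1_basis v) ->
  haar_ell1_plus e.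
Proof.
move=> e1 eb ell1 A [Ainf Aunion Atriv Aref].
(* The codes 0 and 1 belong to no level [m >= 1] and get some infinite set as a default. *)
pose B k := if (k < 2)%N then A 1%N 0%N
  else A (trunc_log 2 k) (k - 2 ^ trunc_log 2 k)%N.
have BE m j : (0 < m)%N -> (j < 2 ^ m)%N -> B (2 ^ m + j)%N = A m j.
  move=> m0 jm; have t : trunc_log 2 (2 ^ m + j) = m.
    by apply: trunc_log_eq => //;
      rewrite leq_addr /= expnS mul2n -addnn ltn_add2l.
  rewrite /B t addKn ifF //; apply/negbTE; rewrite -leqNgt.
  by apply: leq_trans (leq_addr _ _); case: m m0 {jm t} => // m _;
    rewrite expnS leq_pmulr ?expn_gt0.
have Binf k : infinite_set (B k).
  have [k2|k2] := ltnP k 2; first by rewrite /B k2; exact: Ainf.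
  have /andP[h1 h2] := @trunc_log_bounds 2 k isT (ltnW k2).
  have h3 : (k - 2 ^ trunc_log 2 k < 2 ^ trunc_log 2 k)%N.
    by move: h2; rewrite expnS; lia.
  rewrite -(subnKC h1) BE //; first by apply: Ainf => //; rewrite trunc_log_gt0.
  by rewrite trunc_log_gt0.
have [V [x [v [xe xv xB]]]] := block_asymptotic_model e1 eb Binf.
have [C C0 Cv] := ell1 V x v xe xv.
have main m : (0 < m)%N -> exists i : nat -> nat,
    (forall j, (j < 2 ^ m)%N -> (2 ^ m <= (i j).+1)%N /\ A m j (i j)) /\
    (2 * C)^-1 <= (2 ^+ m)^-1 * `|\sum_(j < 2 ^ m) e (i j)|.
  move=> m0; have h0 : 0 < (2 * C)^-1 by rewrite invr_gt0 mulr_gt0.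
  have [_ _ _ iso] := xv.
  have [N NP] := asymptotically_isometric_near (2 ^ m + 2 ^ m) iso h0.
  have /choice [l lP] k :
    exists l, [/\ (N + k <= l)%N, B k l & x k (N + k)%N = e l].
    by have [l [? ? ?]] := xB k (N + k)%N (leq_addl _ _); exists l.
  exists (fun j => l (2 ^ m + j)%N); split=> [j jm|].
    have [h1 h2 _] := lP (2 ^ m + j)%N; split; last by rewrite -BE.
    by move: h1; lia.
  (* Only the rows coding level [m] are summed; row [k] is read in column [N + k]. *)
  pose a k : R := if (2 ^ m <= k)%N then 1 else 0.
  have i1 j : (j < 2 ^ m + 2 ^ m)%N -> (N <= (N + j).+1)%N.
    by move=> _; exact: leqW (leq_addr _ _).
  have i2 j k : (j < k < 2 ^ m + 2 ^ m)%N -> (N + j < N + k)%N.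
    by move=> /andP[jk _]; rewrite ltn_add2l.
  have i3 j : (j < 2 ^ m + 2 ^ m)%N -> `|a j| <= 1.
    by move=> _; rewrite /a; case: ifP; rewrite ?normr1 ?normr0.
  have := NP (addn N) a i1 i2 i3.
  have sumE (W : completeNormedModType R) (F : nat -> W) :
      \sum_(j < 2 ^ m + 2 ^ m) a j *: F j = \sum_(j < 2 ^ m) F (2 ^ m + j)%N.
    rewrite big_split_ord /= big1 ?add0r => [|j _].
      by apply: eq_bigr => j _; rewrite /a leq_addr scale1r.
    by rewrite /a leqNgt ltn_ord scale0r.
  rewrite (sumE _ (fun j => x j (N + j)%N)) (sumE _ v).
  have -> : \sum_(j < 2 ^ m) x (2 ^ m + j)%N (N + (2 ^ m + j))%N =
      \sum_(j < 2 ^ m) e (l (2 ^ m + j)%N).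
    by apply: eq_bigr => j _; have [_ _ ->] := lP (2 ^ m + j)%N.
  move=> close.
  have := (Cv (2 ^ m + 2 ^ m)%N a); rewrite sumE => /andP[low _].
  have sa : \sum_(i < 2 ^ m + 2 ^ m) `|a i| = 2 ^+ m.
    rewrite big_split_ord /= big1 ?add0r => [|j _].
      under eq_bigr do rewrite /a leq_addr normr1.
      by rewrite sumr_const card_ord natrX.
    by rewrite /a leqNgt ltn_ord normr0.
  rewrite sa in low.
  have m1 : (1 : R) <= 2 ^+ m by rewrite exprn_ege1 // ler1n.
  rewrite [leRHS]mulrC ler_pdivlMr ?exprn_gt0 //.
  have : (2 * C)^-1 <= (2 * C)^-1 * 2 ^+ m by rewrite ler_peMr // ltW.
  (* Half of the lower bound [C^-1 * 2 ^+ m] pays for the approximation error, which is below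
     [(2 * C)^-1]. *)
  move: low close; have -> : C^-1 = (2 * C)^-1 + (2 * C)^-1 by field;
    rewrite gt_eqF.
  by rewrite ltr_norml; set s := `|_|; set t := `|_|; lra.
have mainP n : exists2 r, haar_averages e A n r & (2 * C)^-1 <= r.
  have [i [iA iC]] := main n.+1 isT.
  exists ((2 ^+ n.+1)^-1 * `|\sum_(j < 2 ^ n.+1) e (i j)|) => //.
  by exists n.+1, i; split.
have ne n : haar_averages e A n !=set0 by have [r] := mainP n; exists r.
exists (Num.max 1 (2 * C)); first by rewrite le_max lexx.
apply: limr_ge; first exact: sup_haar_averages_cvg.
near=> n; have [r rn rC] := mainP n.
apply: le_trans (ub_le_sup _ rn); last by exists 1; exact: haar_averages_le1.
apply: le_trans rC; rewrite lef_pV2 ?posrE ?mulr_gt0 // ?lt_max ?ltr01 //.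
by rewrite le_max lexx orbT.
Unshelve. all: by end_near. Qed.

(** * Spreading models *)

(** Labels the residue classes modulo [2 ^ n] by their reversed binary digits. The next digit of [i]
    becomes the last digit of the label, so class [j] splits into classes [2 * j] and
    [2 * j + 1]. *)
Fixpoint bit_reversal (n i : nat) : nat :=
  if n is n'.+1 then (odd i * 2 ^ n' + bit_reversal n' i./2)%N else 0%N.

Lemma bit_reversal_lt n i : (bit_reversal n i < 2 ^ n)%N.
Proof.
elim: n i => [|n IH] i //=; have := IH i./2; rewrite expnS.
by case: (odd i) => /=; lia.
Qed.

Lemma bit_reversal_half n i : (bit_reversal n.+1 i)./2 = bit_reversal n i.
Proof.
elim: n i => [|n IH] i; first by rewrite /= expn0 muln1 addn0; case: (odd i).
rewrite -[bit_reversal n.+2 i]/(odd i * 2 ^ n.+1 + bit_reversal n.+1 i./2)%N.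
by rewrite halfD IH expnS mulnCA mul2n odd_double doubleK /=.
Qed.

Lemma haar_system_bit_reversal :
  haar_system (fun n j => [set i | bit_reversal n i = j]).
Proof.
split=> [n j _ jn|n _|n _|n j _ _].
- apply/infinite_natP => N; elim: n j jn => [|n IH] j jn.
    by exists N; split=> //=; move: jn; case: j.
  have [nj|nj] := leqP (2 ^ n) j.
    have [|l [Nl lj]] := IH (j - 2 ^ n)%N; first by move: jn; rewrite expnS;
      lia.
    exists l.*2.+1; split; first by lia.
    by rewrite /= odd_double /= uphalf_double lj; lia.
  have [l [Nl lj]] := IH j nj; exists l.*2; split; first by lia.
  by rewrite /= odd_double doubleK lj.
- rewrite -subTset => i _; exists (bit_reversal n i) => //=.
  exact: bit_reversal_lt.
- by move=> j k _ _ [i [/= <- <-]].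
- have key r : r./2 = j <-> r = (2 * j)%N \/ r = (2 * j).+1 by lia.
  apply/seteqP; split=> i; have := key (bit_reversal n.+1 i);
    by rewrite bit_reversal_half => -[].
Qed.

Lemma increasing_of_succ (n : nat) (p : nat -> nat) :
  (forall j, (j.+1 < n)%N -> (p j < p j.+1)%N) ->
  forall j k, (j < k < n)%N -> (p j < p k)%N.
Proof.
move=> H j k /andP[]; elim: k => // k IH; rewrite ltnS leq_eqVlt.
move=> /predU1P[->|jk] kn; first exact: H.
by apply: ltn_trans (IH jk (ltnW kn)) (H _ kn).
Qed.

(** On division by arbitrarily large [M] the fixed error [E] disappears. *)
Lemma le_of_asymptotic_slope (R : realType) (P D E : R) :
  (forall n, exists2 M, (n < M)%N & M%:R * P <= M%:R * D + E) -> P <= D.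
Proof.
move=> H; rewrite leNgt; apply/negP => DP.
have d0 : 0 < P - D by rewrite subr_gt0.
have [M] := H (Num.truncn (E / (P - D))).
have := truncnS_gt (E / (P - D)); set t := Num.truncn _ => h tM.
have : E / (P - D) < M%:R by apply: lt_le_trans h _; rewrite ler_nat.
by rewrite ltr_pdivrMr // mulrBr; lra.
Qed.

Section Pairs.
Variables (R : realType) (V : completeNormedModType R).
Implicit Types (w : nat -> V) (a : nat -> R) (p q : nat -> nat).

Definition interleave p q : nat -> nat :=
  fun k => if odd k then q k./2 else p k./2.
Definition alternate a : nat -> R :=
  fun k => if odd k then - a k./2 else a k./2.

Lemma sum_interleave w a p q n :
  \sum_(k < n.*2) alternate a k *: w (interleave p q k) =
  \sum_(j < n) a j *: (w (p j) - w (q j)).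
Proof.
elim: n => [|n IH]; first by rewrite !big_ord0.
rewrite doubleS !big_ord_recr /= IH /alternate /interleave /=.
rewrite odd_double /= uphalf_double doubleK scalerBr scaleNr.
by rewrite addrA.
Qed.

Lemma interleave_increasing p q n :
  (forall j, (j < n)%N -> (p j < q j)%N) ->
  (forall j, (j.+1 < n)%N -> (q j < p j.+1)%N) ->
  forall j k, (j < k < n.*2)%N -> (interleave p q j < interleave p q k)%N.
Proof.
move=> pq qp; apply: increasing_of_succ => j jn; rewrite /interleave /=.
have [jo|je] := boolP (odd j).
  by rewrite (_ : uphalf j = j./2.+1); [apply: qp|]; lia.
by rewrite (_ : uphalf j = j./2); [apply: pq|]; lia.
Qed.

Lemma interleave_double k : interleave double (fun j => j.*2.+1) k = k.
Proof. by rewrite /interleave; case: ifP; lia. Qed.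

End Pairs.

(** * Lower l1 estimates for spreading sequences *)

Section Spreading.
Variables (R : realType) (V : completeNormedModType R) (v : nat -> V).
Hypothesis v1 : normalized v.
Hypothesis v_spreading : forall n (a : nat -> R) (p : nat -> nat),
  (forall j k, (j < k < n)%N -> (p j < p k)%N) ->
  `|\sum_(j < n) a j *: v (p j)| = `|\sum_(j < n) a j *: v j|.
Implicit Types (a : nat -> R) (p q : nat -> nat).

Let d j : V := v j.*2 - v j.*2.+1.

(** The positions [p 0 < q 0 < p 1 < q 1 < ...] increase, so both sides have the norm of the same
    alternating combination of the first [2 * n] vectors. *)
Let pairs_norm a p q n :
  (forall j, (j < n)%N -> (p j < q j)%N) ->
  (forall j, (j.+1 < n)%N -> (q j < p j.+1)%N) ->
  `|\sum_(j < n) a j *: (v (p j) - v (q j))| = `|\sum_(j < n) a j *: d j|.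
Proof.
move=> pq qp; rewrite -(sum_interleave v a p q) v_spreading; last first.
  exact: interleave_increasing.
have -> : \sum_(j < n) a j *: d j = \sum_(k < n.*2)
    alternate a k *: v (interleave double (fun j => j.*2.+1) k).
  by rewrite sum_interleave.
rewrite v_spreading //; apply: interleave_increasing => j jn;
  first exact: ltnSn.
by rewrite doubleS.
Qed.

Let telescope b S : \sum_(s < S) (v (b + s)%N - v (b + s).+1) =
  v b - v (b + S)%N.
Proof.
elim: S => [|S IH]; first by rewrite big_ord0 addn0 subrr.
by rewrite big_ord_recr /= IH addnS addrA subrK.
Qed.

(* Moving only the negative terms along the basis makes them telescope in the
   average, whereas the norm does not change. *)
Lemma pairs_positive_part (a : nat -> R) n :
  `|\sum_(j < n) Num.max (a j) 0 *: d j| <= `|\sum_(j < n) a j *: d j|.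
Proof.
apply: (@le_of_asymptotic_slope _ _ _ (2 * \sum_(j < n) `|a j|)) => S0.
exists S0.+1 => //; set S := S0.+1.
(* Gaps of [S + 2] leave room for a pair shifted by any [s < S] before the next pair. *)
pose b j := (j * S.+2)%N.
pose p s j := if 0 <= a j then b j else (b j + s)%N.
have TE s : (s < S)%N -> `|\sum_(j < n) a j *: (v (p s j) - v (p s j).+1)| =
    `|\sum_(j < n) a j *: d j|.
  move=> sS; apply: (@pairs_norm a (p s) (fun j => (p s j).+1)) => j _;
    rewrite /p /b //.
  by rewrite mulSn; do 2 case: ifP => _; lia.
have <- : `|\sum_(j < n) Num.max (a j) 0 *: (v (b j) - v (b j).+1)| =
    `|\sum_(j < n) Num.max (a j) 0 *: d j|.
  by apply: (@pairs_norm (fun j => Num.max (a j) 0) b (fun j =>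
    (b j).+1)) => j _; rewrite /b // mulSn; lia.
(* Over the [S] shifts a nonnegative term is repeated [S] times, while a negative one telescopes to
   a multiple of a difference of two basis vectors. *)
have sumT : \sum_(s < S) \sum_(j < n) a j *: (v (p s j) - v (p s j).+1) =
    S%:R *: \sum_(j < n) Num.max (a j) 0 *: (v (b j) - v (b j).+1) +
    \sum_(j < n) Num.min (a j) 0 *: (v (b j) - v (b j + S)%N).
  rewrite exchange_big scaler_sumr -big_split /=; apply: eq_bigr => j _.
  rewrite -scaler_sumr /p; have [a0|a0] := leP 0 (a j).
    rewrite scale0r addr0 sumr_const card_ord scalerA mulrC -scalerA.
    by rewrite scaler_nat.
  by rewrite scale0r scaler0 add0r telescope.
have := congr1 (fun z => `|z - \sum_(j < n) Num.min (a j) 0 *: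
  (v (b j) - v (b j + S)%N)|) sumT.
rewrite addrK normrZ ger0_norm // => <-.
apply: le_trans (ler_normB _ _) _; apply: lerD.
  apply: le_trans (ler_norm_sum _ _ _) _.
  under eq_bigr => s _ do rewrite TE ?ltn_ord //.
  by rewrite sumr_const card_ord mulr_natl.
apply: le_trans (ler_norm_sum _ _ _) _; rewrite mulr_sumr;
  apply: ler_sum => j _.
rewrite normrZ mulrC; apply: ler_pM => //.
  by apply: le_trans (ler_normB _ _) _; rewrite !v1.
by have [a0|a0] := leP 0 (a j); rewrite ?normr0.
Qed.

Let d_le2 j : `|d j| <= 2.
Proof. by apply: le_trans (ler_normB _ _) _; rewrite !v1. Qed.

(** The two windows differ in at most [j] terms at each end, each of norm at most 2. *)
Let window j M : `|\sum_(w < M) d (w + j)%N - \sum_(t < M) d t| <= 4 * j%:R.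
Proof.
elim: j => [|j IH].
  by under eq_bigr do rewrite addn0; rewrite subrr normr0 mulr0.
have -> : \sum_(w < M) d (w + j.+1)%N = \sum_(w <
  M) d (w + j)%N + (d (M + j)%N - d j).
  elim: M {IH} => [|M IH]; first by rewrite !big_ord0 add0n subrr addr0.
  rewrite !big_ord_recr /= IH -addSnnS -addrA -[RHS]addrA; congr (_ + _).
  by rewrite -addrA; congr (_ + _); exact: addrC.
rewrite addrAC; apply: le_trans (ler_normD _ _) _.
apply: le_trans (lerD IH (ler_normB _ _)) _.
by rewrite -[j.+1%:R]natr1 mulrDr mulr1 lerD2l (le_trans (lerD (d_le2 _) (d_le2
  _))) //; lra.
Qed.

(* Averaging the translates of a nonnegative combination flattens its
   coefficients. *)
Lemma pairs_ge0_lower (c : R) a n :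
  (forall m, exists2 M, (m < M)%N & c * M%:R <= `|\sum_(t < M) d t|) ->
  (forall j, 0 <= a j) ->
  c * \sum_(j < n) a j <= `|\sum_(j < n) a j *: d j|.
Proof.
move=> Hc a0; pose A := \sum_(j < n) a j.
have A0 : 0 <= A by apply: sumr_ge0.
apply: (@le_of_asymptotic_slope _ _ _ (\sum_(j < n) a j * (4 * j%:R))) => m.
have [M mM cM] := Hc m; exists M => //.
have TE w : `|\sum_(j < n) a j *: d (w + j)%N| = `|\sum_(j < n) a j *: d j|.
  by apply: (@pairs_norm a (fun j => (w + j).*2) (fun j =>
    (w + j).*2.+1)) => j _; lia.
have H1 : `|\sum_(w < M) \sum_(j < n) a j *: d (w + j)%N| <=
    M%:R * `|\sum_(j < n) a j *: d j|.
  apply: le_trans (ler_norm_sum _ _ _) _.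
  by under eq_bigr do rewrite TE; rewrite sumr_const card_ord mulr_natl.
(* After exchanging the sums, [a j] multiplies a whole window of [d] shifted by [j]. *)
have H2 : `|A *: \sum_(t < M) d t - \sum_(w < M) \sum_(j < n) a j *:
  d (w + j)%N|
    <= \sum_(j < n) a j * (4 * j%:R).
  rewrite exchange_big /= /A scaler_suml -sumrB.
  apply: le_trans (ler_norm_sum _ _ _) _; apply: ler_sum => j _.
  rewrite -scaler_sumr -scalerBr normrZ ger0_norm // distrC.
  by apply: ler_wpM2l; [exact: a0 | exact: window].
apply: (@le_trans _ _ `|A *: \sum_(t < M) d t|).
  by rewrite normrZ ger0_norm // mulrC mulrAC mulrC ler_wpM2l.
rewrite -[X in `|X|](subrK (\sum_(w < M) \sum_(j < n) a j *: d (w + j)%N)).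
by rewrite addrC; apply: le_trans (ler_normD _ _) (lerD _ _).
Qed.

(** The bounds for the positive parts of [a] and of [- a] add up to [c] times the l1 norm, at most
    twice the norm over [d]. The latter is at most twice the norm over [v]; hence [4 / c]. *)
Lemma spreading_ell1 (c : R) : 0 < c ->
  (forall m, exists2 M, (m < M)%N & c * M%:R <= `|\sum_(t < M) d t|) ->
  equivalent_to_ell1_basis v.
Proof.
move=> c0 Hc; exists (Num.max 1 (4 / c)) => [|n a].
  by rewrite lt_max ltr01.
apply/andP; split; last first.
  apply: le_trans (ler_norm_sum _ _ _) _.
  under eq_bigr do rewrite normrZ v1 mulr1.
  by rewrite ler_peMl ?le_max ?lexx // sumr_ge0.
have lower (b : nat -> R) :
  c * \sum_(j < n) Num.max (b j) 0 <= `|\sum_(j < n) b j *: d j|.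
  apply: le_trans (pairs_positive_part _ _).
  apply: (@pairs_ge0_lower c (fun j => Num.max (b j) 0) n Hc) => j.
  by rewrite le_max lexx orbT.
have h1 := lower a; have := lower (- a).
rewrite (_ : \sum_(j < n) (- a) j *: d j = - \sum_(j < n) a j *: d j);
  last first.
  by rewrite -sumrN; apply: eq_bigr => j _; rewrite -scaleNr.
rewrite normrN => h2.
have abs_sum : \sum_(j < n) `|a j| =
    \sum_(j < n) Num.max (a j) 0 + \sum_(j < n) Num.max ((- a) j) 0.
  rewrite -big_split; apply: eq_bigr => j _.
  rewrite -[(- a) j]/(- a j); have [a0|a0] := leP 0 (a j).
    by rewrite [LHS]ger0_norm // [Num.max _ _]max_r ?oppr_le0 //= addr0.
  by rewrite [LHS]ltr0_norm // [Num.max _ _]max_l ?oppr_ge0 ?(ltW a0) //= add0r.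
have h3 : `|\sum_(j < n) a j *: d j| <= 2 * `|\sum_(j < n) a j *: v j|.
  under eq_bigr do rewrite /d scalerBr.
  rewrite sumrB; apply: le_trans (ler_normB _ _) _.
  rewrite (v_spreading a (p := fun j => j.*2)); last by move=> j k; lia.
  rewrite (v_spreading a (p := fun j => j.*2.+1)); last by move=> j k; lia.
  by lra.
have S0 : 0 <= \sum_(j < n) `|a j| by apply: sumr_ge0.
apply: (@le_trans _ _ ((4 / c)^-1 * \sum_(j < n) `|a j|)).
  apply: ler_wpM2r => //; rewrite lef_pV2 ?posrE ?divr_gt0 // ?lt_max ?ltr01 //.
  by rewrite le_max lexx orbT.
rewrite invf_div mulrAC ler_pdivrMr // abs_sum; lra.
Qed.

End Spreading.

(** * Spreading models of spaces with Haar-l1+ basic sequences *)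

Lemma spreading_model_spreading (R : realType) (X V : completeNormedModType R)
    (e : nat -> X) (v : nat -> V) (n : nat) (a : nat -> R) (p : nat -> nat) :
  asymptotically_isometric (fun=> e) v ->
  (forall j k, (j < k < n)%N -> (p j < p k)%N) ->
  `|\sum_(j < n) a j *: v (p j)| = `|\sum_(j < n) a j *: v j|.
Proof.
move=> iso pinc.
(* By homogeneity. The bound makes [a], and its redistribution [b] to the positions [p j], have
   entries of modulus at most 1. Far out along [e], one sum over the positions [N + p j] then
   approximates both sides. *)
wlog a1 : a / \sum_(j < n) `|a j| <= 1 => [WL|].
  pose l := 1 + \sum_(j < n) `|a j|.
  have l0 : 0 < l by rewrite ltr_pwDl // sumr_ge0.
  have := WL (fun j => l^-1 * a j).
  have E (F : nat -> V) : \sum_(j < n) (l^-1 * a j) *: F j = l^-1 *: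
    \sum_(j < n) a j *: F j.
    by rewrite scaler_sumr; apply: eq_bigr => j _; rewrite scalerA.
  rewrite (E (fun j => v (p j))) E !normrZ.
  have H : \sum_(j < n) `|l^-1 * a j| <= 1.
    under eq_bigr do rewrite normrM normfV (gtr0_norm l0).
    by rewrite -mulr_sumr mulrC ler_pdivrMr // mul1r /l lerDr.
  by move/(_ H)/mulfI; apply; rewrite normr_eq0 invr_eq0 gt_eqF.
apply/eqP; rewrite -subr_eq0 -normr_le0; apply/ler_addgt0Pr => eps e0.
have h0 : 0 < eps / 2 by rewrite divr_gt0.
pose M := (\max_(j < n) p j).+1.
have pM j : (j < n)%N -> (p j < M)%N.
  by move=> jn; rewrite ltnS; exact: (leq_bigmax (Ordinal jn)).
have [N1 P1] := asymptotically_isometric_near M iso h0.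
have [N2 P2] := asymptotically_isometric_near n iso h0.
pose N := maxn N1 N2.
pose b i := \sum_(j < n) a j * (i == p j)%:R.
have bE (W : completeNormedModType R) (F : nat -> W) :
    \sum_(i < M) b i *: F i = \sum_(j < n) a j *: F (p j).
  under eq_bigr do rewrite /b scaler_suml.
  rewrite exchange_big /=; apply: eq_bigr => j _.
  rewrite (bigD1 (Ordinal (pM _ (ltn_ord j)))) //= eqxx mulr1 big1 ?addr0 //.
  by move=> i; rewrite -val_eqE /= => /negbTE ->; rewrite mulr0 scale0r.
have b1 i : (i < M)%N -> `|b i| <= 1.
  move=> _; apply: le_trans a1; apply: le_trans (ler_norm_sum _ _ _) _.
  apply: ler_sum => j _; rewrite normrM.
  by case: eqP; rewrite ?normr1 ?normr0 ?mulr1 ?mulr0.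
have H1 := P1 (addn N) b _ _ b1.
have a1' j : (j < n)%N -> `|a j| <= 1.
  move=> jn; apply: le_trans a1.
  by rewrite (bigD1 (Ordinal jn)) //= lerDl sumr_ge0.
have := P2 (fun j => N + p j)%N a _ _ a1'.
rewrite (bE _ (fun i => e (N + i)%N)) bE in H1 => H2.
have {}H1 : `| `|\sum_(j < n) a j *: e (N + p j)%N| - `|\sum_(j < n) a j *:
  v (p j)| | < eps / 2.
  apply: H1 => [j _|j k /andP[jk _]]; last by rewrite ltn_add2l.
  by apply: leqW; rewrite (leq_trans (leq_maxl N1 N2)) // leq_addr.
have {}H2 : `| `|\sum_(j < n) a j *: e (N + p j)%N| - `|\sum_(j < n) a j *:
  v j| | < eps / 2.
  apply: H2 => [j _|j k jk]; last by rewrite ltn_add2l pinc.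
  by apply: leqW; rewrite (leq_trans (leq_maxr N1 N2)) // leq_addr.
move: H1 H2; set s := `|\sum_(j < n) a j *: e (N + p j)%N|.
rewrite add0r !ltr_norml ler_norml; lra.
Qed.

Lemma spreading_model_ell1 (R : realType) (X V : completeNormedModType R)
    (e : nat -> X) (v : nat -> V) :
  (forall w : nat -> X, normalized w -> basic w -> haar_ell1_plus w) ->
  spreading_model e v -> equivalent_to_ell1_basis v.
Proof.
move=> haar [e1 [K eK] v1 _ iso].
have [K1 e0 eK'] := eK.
have v_spr n a p := @spreading_model_spreading R X V e v n a p iso.
have K0 : 0 < K by apply: lt_le_trans K1.
(* Starting at [2i + 1] makes the pairs admissible: [2 ^ m <= i + 1] gives
   [2 ^ m.+1 <= (2i + 1) + 1]. *)
pose u i : X := e i.*2.+1 - e i.*2.+2.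
have u_ge i : K^-1 <= `|u i|.
  rewrite -[K^-1]mul1r ler_pdivrMr // mulrC -(e1 i.*2.+1).
  (* Cutting off the second term of [u i] costs a factor [K], so [u i] has norm at least [K^-1]. *)
  pose a k : R := if k == i.*2.+1 then 1 else if k == i.*2.+2 then -1 else 0.
  have := eK' a i.*2.+2 i.*2.+3 (leqnSn _).
  have z : \sum_(k < i.*2.+1) a k *: e k = 0.
    apply: big1 => k _; have := ltn_ord k => ki.
    by rewrite /a ltn_eqF // ltn_eqF ?scale0r // ltnW.
  have z1 : \sum_(k < i.*2.+2) a k *: e k = e i.*2.+1.
    by rewrite big_ord_recr /= z add0r /a eqxx scale1r.
  by rewrite [in leRHS]big_ord_recr /= z1 /a gtn_eqF // eqxx scaleN1r.
have u0 i : 0 < `|u i| by apply: lt_le_trans (u_ge i); rewrite invr_gt0.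
pose w i := `|u i|^-1 *: u i.
have w1 : normalized w.
  by move=> i; rewrite normrZ normfV normr_id mulVf // gt_eqF.
have wb : basic w.
  exists K; apply: K_basic_of_fin => N.
  apply: (@blocks_K_basic_fin R X K e w N (fun j => j.*2.+1)
    (fun j k => `|u j|^-1 * ((k == j.*2.+1)%:R - (k == j.*2.+2)%:R))) => //.
  - by move=> j _; lia.
  - move=> j k _; have [->|k1] := eqVneq k j.*2.+1; first by move=> _; lia.
    have [->|k2] := eqVneq k j.*2.+2; first by move=> _; lia.
    by rewrite subrr mulr0 eqxx.
  - move=> j _; rewrite doubleS !big_ord_recr /= big1 => [|k _].
      have f1 : (j.*2 == j.*2.+1) = false by lia.
      have f2 : (j.*2 == j.*2.+2) = false by lia.
      have f3 : (j.*2.+1 == j.*2.+2) = false by lia.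
      have f4 : (j.*2.+2 == j.*2.+1) = false by lia.
      rewrite f1 f2 f3 f4 !eqxx subrr mulr0 scale0r !add0r subr0 mulr1 mulrN1
        scaleNr.
      by rewrite /w /u scalerBr.
    have := ltn_ord k => ki.
    by rewrite (ltn_eqF (leqW ki)) (ltn_eqF (leqW (leqW ki))) subrr mulr0
      scale0r.
  - by move=> j _; rewrite -normr_gt0 w1.
pose A n j := [set i | bit_reversal n i = j].
have HA : haar_system A := haar_system_bit_reversal.
have ne n : haar_averages w A n !=set0.
  have [Ainf _ _ _] := HA.
  have /choice [i iP] j :
    exists l, (j < 2 ^ n.+1)%N -> (2 ^ n.+1 <= l)%N /\ A n.+1 j l.
    have [jn|jn] := ltnP j (2 ^ n.+1); last by exists 0%N.
    by have [l lP] := (infinite_natP _).1 (Ainf n.+1 j isT jn) (2 ^ n.+1)%N;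
      exists l.
  exists ((2 ^+ n.+1)^-1 * `|\sum_(j < 2 ^ n.+1) w (i j)|), n.+1, i;
    split=> // j jn.
  by have [h1 h2] := iP j jn; split=> //; exact: leqW.
have [C C1 CA] := haar w w1 wb A HA.
have C0 : 0 < C by apply: lt_le_trans C1.
(* The suprema decrease to a limit at least [C^-1], so each exceeds [(2 * C)^-1], and so does some
   average. *)
have avg n : exists2 r, haar_averages w A n r & (2 * C)^-1 < r.
  apply: sup_gt; first exact: ne.
  apply: (@lt_le_trans _ _ C^-1).
    by rewrite ltf_pV2 ?posrE ?mulr_gt0 // ltr_pMl // ltr1n.
  apply: le_trans CA _; apply: nonincreasing_cvgn_ge.
    exact: sup_haar_averages_nonincreasing.
  exact: sup_haar_averages_cvg.
pose d j : V := v j.*2 - v j.*2.+1.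
(* The limit of the norms of the [u i]; it is positive because these are at least [K^-1]. *)
pose theta := `|d 0%N|.
have sum2 (W : completeNormedModType R) (F : nat -> W) :
    \sum_(j < 2) (if j == 0%N :> nat then 1 else -1 : R) *: F j = F 0%N - F 1%N.
  by rewrite !big_ord_recr big_ord0 /= add0r scale1r scaleN1r.
have utheta eps : 0 < eps -> exists N, forall i, (N <=
  i)%N -> `| `|u i| - theta| < eps.
  move=> e'0; have [N NP] := asymptotically_isometric_near 2 iso e'0.
  exists N => i Ni.
  have := NP (fun j => i.*2.+1 + j)%N (fun j => if j == 0%N then 1 else -1).
  rewrite (sum2 _ (fun j => e (i.*2.+1 + j)%N)) sum2 addn0 addn1; apply.
  - by move=> j _; lia.
  - by move=> j k; lia.
  - by move=> j _; case: eqP; rewrite ?normrN ?normr1.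
have theta0 : 0 < theta.
  have h0 : 0 < K^-1 by rewrite invr_gt0.
  have [N NP] := utheta _ h0.
  by have := NP N (leqnn N); have := u_ge N; rewrite ltr_norml; lra.
have eta0 : 0 < theta / (8 * C) by rewrite divr_gt0 // mulr_gt0.
have [N NP] := utheta _ eta0.
apply: (@spreading_ell1 R V v v1 v_spr (theta / (4 * C))).
  by rewrite divr_gt0 // mulr_gt0.
move=> m0; have [delta [d0 dmono dlim dP]] := iso.
have /cvgr0_norm_lt /(_ _ eta0) [N' _ N'P] := dlim.
have [r [m [i [mm iA ->]]] Cr] := avg (m0 + N + N')%N.
have m2 : (m < 2 ^ m)%N by apply: ltn_expl.
have Nm : (N < 2 ^ m)%N by move: mm m2; clear; lia.
have N'm : (N' <= (2 ^ m).*2)%N by move: mm m2; clear; lia.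
exists (2 ^ m)%N; first by move: mm m2; clear; lia.
(* The indices [i j] are distinct, since the sets [A m j] are disjoint, but not ordered; sorting
   keeps the sum. *)
pose s := sort leq [seq i j | j <- iota 0 (2 ^ m)].
have s_size : size s = (2 ^ m)%N by rewrite size_sort size_map size_iota.
have s_mem x : x \in s -> (2 ^ m <= x.+1)%N.
  rewrite mem_sort => /mapP[j]; rewrite mem_iota add0n => /andP[_ jm] ->.
  by have [] := iA j jm.
have s_sorted : sorted ltn s.
  rewrite ltn_sorted_uniq_leq sort_sorted; last exact: leq_total.
  rewrite andbT sort_uniq map_inj_in_uniq ?iota_uniq // => j k.
  rewrite !mem_iota !add0n => /andP[_ jm] /andP[_ km] ijk.
  by have [_ <-] := iA j jm; have [_ <-] := iA k km; rewrite ijk.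
pose p t := nth 0%N s t.
have p_ge t : (t < 2 ^ m)%N -> (2 ^ m <= (p t).+1)%N.
  by move=> tm; apply: s_mem; rewrite mem_nth // s_size.
have p_inc t : (t.+1 < 2 ^ m)%N -> (p t < p t.+1)%N.
  move=> tm; apply: (sorted_ltn_nth ltn_trans) => //; rewrite inE s_size //.
  exact: ltnW.
have sumw : \sum_(j < 2 ^ m) w (i j) = \sum_(t < 2 ^ m) w (p t).
  rewrite -(big_mkord xpredT (fun j =>
    w (i j))) -(big_mkord xpredT (fun t => w (p t))).
  rewrite -[in RHS]s_size -(big_nth 0%N xpredT w) (perm_big _ (permEl
    (perm_sort _ _))).
  by rewrite big_map /index_iota subn0.
rewrite sumw in Cr.
have H1 : `|theta *: \sum_(t < 2 ^ m) w (p t) - \sum_(t < 2 ^ m) u (p t)| <=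
    2 ^+ m * (theta / (8 * C)).
  rewrite scaler_sumr -sumrB; apply: le_trans (ler_norm_sum _ _ _) _.
  rewrite -natrX mulr_natl -[X in _ *+ X]card_ord -sumr_const.
  apply: ler_sum => t _; have := NP (p t) _.
  have U0 := u0 (p t).
  have -> : theta *: w (p t) - u (p t) =
    ((theta - `|u (p t)|) / `|u (p t)|) *: u (p t).
    by rewrite mulrBl divff ?gt_eqF // scalerBl scale1r /w scalerA.
  rewrite normrZ normrM normfV normr_id divfK ?gt_eqF // distrC.
  by move=> h; apply/ltW/h; rewrite -ltnS (leq_trans Nm) ?p_ge.
have H2 : `| `|\sum_(t < 2 ^ m) u (p t)| - `|\sum_(t < 2 ^ m) d t| | <
  theta / (8 * C).
  have := dP (2 ^ m).*2 (interleave (fun t => (p t).*2.+1) (fun t =>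
    (p t).*2.+2))
    (alternate (fun=> 1)).
  rewrite (sum_interleave e).
  have -> : \sum_(j < (2 ^ m).*2) alternate (fun=> 1) j *:
    v j = \sum_(t < 2 ^ m) d t.
    have := sum_interleave v (fun=> 1) double (fun t => t.*2.+1) (2 ^ m).
    under [RHS]eq_bigr do rewrite scale1r.
    by move=> <-; apply: eq_bigr => k _; rewrite interleave_double.
  under eq_bigr do rewrite scale1r.
  move=> H; apply: lt_trans (le_lt_trans (ler_norm _) (N'P _ _)).
    apply: H; last by move=> j _; rewrite /alternate; case: ifP;
      rewrite ?normrN normr1.
    split; last first.
      by apply: interleave_increasing => j jm;
        [exact: ltnSn|rewrite ltnS ltn_Sdouble p_inc].
    move=> j; rewrite -ltn_half_double => /p_ge; rewrite /interleave.
    by case: ifP => _; move: (p _) (2 ^ m)%N; clear; lia.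
  exact: N'm.
have c2 : (1 : R) <= 2 ^+ m by rewrite exprn_ege1 // ler1n.
have H3 : theta * 2 ^+ m / (2 * C) <= `|theta *: \sum_(t < 2 ^ m) w (p t)|.
  rewrite normrZ (ger0_norm (ltW theta0)) -mulrA; apply: ler_wpM2l;
    first exact: ltW.
  by move/ltW: Cr; rewrite [leRHS]mulrC ler_pdivlMr ?exprn_gt0 // => Cr;
    rewrite mulrC.
have H4 := ler_dist_dist (theta *:
  \sum_(t < 2 ^ m) w (p t)) (\sum_(t < 2 ^ m) u (p t)).
have {H1 H4} H5 := le_trans H4 H1.
rewrite natrX.
(* In units of [2 ^+ m * (theta / (8 * C))] the average provides 4; replacing [theta *: w] by [u]
   and passing from [e] to [v] cost at most 1 each; 2 remain. *)
have E1 : theta / (4 * C) * 2 ^+ m = 2 * (2 ^+ m * (theta / (8 * C))).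
  by field; rewrite gt_eqF.
have E2 : theta * 2 ^+ m / (2 * C) = 4 * (2 ^+ m * (theta / (8 * C))).
  by field; rewrite gt_eqF.
have E3 : theta / (8 * C) <=
  2 ^+ m * (theta / (8 * C)) by rewrite ler_peMl // ltW.
rewrite E1; rewrite E2 in H3.
move: H2 H5 H3 E3; rewrite ltr_norml ler_norml.
set x1 := `|theta *: _|; set x2 := `|\sum_(t < _) u _|;
  set x3 := `|\sum_(t < _) d t|.
by set x4 := _ / _; set x5 := _ * x4; lra.
Qed.

(** * Selecting a basic sequence *)

Section BasicSelection.
Variables (R : realType) (X : completeNormedModType R).
Implicit Types (y : nat -> X) (a : nat -> R) (S : set X).

(** The term [a j *: y j] is a difference of two partial sums, each at most twice the whole. *)
Lemma basic_coefficient (c : R) n y a j : 0 < c ->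
  K_basic_fin 2 n y -> (forall i, (i < n)%N -> c < `|y i|) -> (j < n)%N ->
  `|a j| <= 4 / c * `|\sum_(i < n) a i *: y i|.
Proof.
move=> c0 [_ _ yK] yc jn.
have h1 := yK a j n; have h2 := yK a j.+1 n.
have {}h1 : `|\sum_(i < j) a i *: y i| <= 2 * `|\sum_(i < n) a i *: y i|.
  by apply: h1; rewrite leqnn ltnW.
have {}h2 : `|\sum_(i < j.+1) a i *: y i| <= 2 * `|\sum_(i < n) a i *: y i|.
  by apply: h2; rewrite leqnn jn.
rewrite mulrAC ler_pdivlMr //.
have : `|a j| * c <= `|a j *: y j|.
  by rewrite normrZ ler_wpM2l // ltW // yc.
move/le_trans; apply.
have -> : a j *: y j = \sum_(i < j.+1) a i *: y i - \sum_(i < j) a i *: y i.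
  by rewrite big_ord_recr /= addrAC subrr add0r.
by apply: le_trans (ler_normB _ _) _; move: h1 h2; lra.
Qed.

(* What one gets from vectors of [S] on which finitely many functionals norming
   the [g k] are small, stated without functionals. *)
Definition almost_annihilated S := forall (I : finType) (g : I -> X) (s :
  I -> R)
  (eps : R), 0 < eps ->
  exists2 x, S x & forall k, `|g k| - eps <= `|g k + s k *: x|.

Lemma basic_extension (c B q : R) n y S : 0 < c -> 1 < q ->
  K_basic_fin 2 n y -> (forall i, (i < n)%N -> c < `|y i| <= B) ->
  (forall x, S x -> c < `|x| <= B) -> almost_annihilated S ->
  exists2 x, S x & forall a (s : R),
    `|\sum_(i < n) a i *: y i| <= q * `|\sum_(i < n) a i *: y i + s *: x|.
Proof.
move=> c0 q1 yK yc Sc Sann.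
have q0 : 0 < q by apply: lt_trans q1.
(* The loss allowed on a vector of norm 1: half for the choice of [x], the other half for
   approximation by the net. *)
pose delta := 1 - q^-1.
have delta0 : 0 < delta by rewrite subr_gt0 invf_lt1.
pose B' := `|B| + 1.
have B'0 : 0 < B' by rewrite ltr_wpDl.
pose eta := delta / (4 * n.+1%:R * B').
have eta0 : 0 < eta by rewrite divr_gt0 // !mulr_gt0.
(* Coefficients of a vector of norm 1 have modulus at most [4 / c]; the last coordinate of the net
   serves for [s]. *)
have [I [G GP]] := cube_net (4 / c) n.+1 eta0.
have d2 : 0 < delta / 2 by rewrite divr_gt0.
have [x Sx xP] := Sann I (fun k => \sum_(i < n) G k i *: y i) (fun k =>
  G k n) _ d2.
exists x => // a s.
have leB' z : `|z| <= B -> `|z : X| <= B'.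
  by move=> /le_trans; apply; rewrite (le_trans (ler_norm _)) // lerDl.
have /andP[xc /leB' xB] := Sc x Sx.
wlog g1 : a s / `|\sum_(i < n) a i *: y i| = 1 => [WL|].
  set g := \sum_(i < n) a i *: y i; have [g0|] := eqVneq `|g| 0.
    by rewrite g0 mulr_ge0 // ltW.
  move=> gn0; have gp : 0 < `|g| by rewrite lt_def gn0 normr_ge0.
  have E : \sum_(i < n) (`|g|^-1 * a i) *: y i = `|g|^-1 *: g.
    by rewrite scaler_sumr; apply: eq_bigr => i _; rewrite scalerA.
  have := WL (fun i => `|g|^-1 * a i) (`|g|^-1 * s).
  rewrite E normrZ normfV normr_id mulVf // => /(_ erefl).
  rewrite -scalerA -scalerDr normrZ normfV normr_id mulrCA mulrC.
  by rewrite ler_pdivlMr // mul1r.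
rewrite g1 -ler_pdivrMl // mulr1.
(* For larger [s] the term [s *: x] has norm at least 4 and dominates. *)
have [sc|sc] := leP `|s| (4 / c); last first.
  have : 4 <= `|s *: x|.
    rewrite normrZ; apply: (@le_trans _ _ (4 / c * `|x|)).
      by rewrite mulrAC ler_pdivlMr // ler_wpM2l // ltW.
    by rewrite ler_wpM2r // ltW.
  have := lerB_normD (s *: x) (\sum_(i < n) a i *: y i);
    rewrite g1 (addrC (s *: x)).
  have : q^-1 < 1 by rewrite invf_lt1.
  by lra.
pose b j := if (j < n)%N then a j else s.
have [|k kP] := GP b.
  move=> j _; rewrite /b; case: ifP => // jn.
  have yc' i : (i < n)%N -> c < `|y i| by move=> /yc /andP[].
  by have := basic_coefficient a c0 yK yc' jn; rewrite g1 mulr1.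
have kn := kP n (ltnSn n); rewrite /b ltnn in kn.
have D1 : `|\sum_(i < n) a i *: y i - \sum_(i < n) G k i *:
  y i| <= n%:R * (eta * B').
  rewrite -sumrB; apply: le_trans (ler_norm_sum _ _ _) _.
  rewrite mulr_natl -[X in _ *+ X]card_ord -sumr_const; apply: ler_sum => i _.
  rewrite -scalerBl normrZ; apply: ler_pM => //.
    by have := kP i (leqW (ltn_ord i)); rewrite /b ltn_ord.
  by have /andP[_ /leB'] := yc i (ltn_ord i).
have D2 : `|s *: x - G k n *: x| <= eta * B'.
  by rewrite -scalerBl normrZ; apply: ler_pM.
have etaE : n%:R * (eta * B') + eta * B' = delta / 4.
  rewrite /eta; have : n%:R + 1 = n.+1%:R :> R by rewrite natr1.
  have n0 : n.+1%:R != 0 :> R by rewrite pnatr_eq0.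
  move=> nE; transitivity ((n%:R + 1) * (delta / (4 * n.+1%:R * B') * B'));
    first by ring.
  by rewrite nE; field; rewrite gt_eqF //= addrC natr1 n0.
have := xP k.
set g := \sum_(i < n) a i *: y i in g1 D1 *.
set h := \sum_(i < n) _ in D1 *.
have T2 : `|h + G k n *: x| <= `|g + s *: x| + `|g - h| + `|s *: x - G k n *:
  x|.
  have -> : h + G k n *: x = g + s *: x - (g - h) - (s *: x - G k n *: x).
    by rewrite -[RHS]addrA -opprD addrACA -opprD opprB [RHS]addrC subrK.
  by apply: le_trans (ler_normB _ _) _; rewrite lerD2r ler_normB.
have T3 : `|g| <= `|g - h| + `|h| by rewrite -[X in `|X|](subrK h) ler_normD.
have dE : q^-1 = 1 - delta by rewrite /delta opprB addrC subrK.
have eB : 0 <= eta * B' by rewrite mulr_ge0 // ltW.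
by rewrite dE; move: T2 T3 D1 D2 etaE eB; rewrite g1; lra.
Qed.

(** Mazur's inductive construction of a basic sequence, with [almost_annihilated] in place of
    kernels of finitely many functionals. *)
Lemma basic_selection (c B : R) (S : nat -> set X) : 0 < c ->
  (forall i x, S i x -> c < `|x| <=
    B) -> (forall i, almost_annihilated (S i)) ->
  exists2 x : nat -> X, forall i, S i (x i) & K_basic 2 x.
Proof.
move=> c0 Sc Sann.
(* The basis constants increase from 1 towards 2, so step [n] may lose a factor
   [K n.+1 / K n > 1]. *)
pose K n : R := 2 - 2^-n.
have K1 n : 1 <= K n.
  have : 2 ^- n <= 1 :> R by rewrite invf_le1 ?exprn_gt0 // exprn_ege1 // ler1n.
  by rewrite /K; lra.
have KS n : K n < K n.+1.
  by rewrite /K ltrD2l ltrN2 ltf_pV2 ?posrE ?exprn_gt0 // ltr_eXn2l ?ltr1n.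
have K2 n : K n <= 2 by rewrite /K gerBl invr_ge0 exprn_ge0.
have K0 n : 0 < K n by apply: lt_le_trans (K1 n).
pose good n y := K_basic_fin (K n) n y /\ forall i, (i < n)%N -> S i (y i).
have ext (h : seq X) : exists x, good (size h) (nth 0 h) ->
    good (size h).+1 (nth 0 (rcons h x)).
  have [[hK hS]|] := pselect (good (size h) (nth 0 h)); last by exists 0.
  set n := size h in hK hS *.
  have hK2 : K_basic_fin 2 n (nth 0 h).
    have [_ h0 hP] := hK; split=> // [|a i m im]; first exact: ler1n.
    by apply: le_trans (hP a i m im) _; rewrite ler_wpM2r.
  have q1 : 1 < K n.+1 / K n by rewrite ltr_pdivlMr // mul1r.
  have hc i : (i < n)%N -> c < `|nth 0 h i| <= B by move=> /hS /Sc.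
  have [x Sx xP] := basic_extension c0 q1 hK2 hc (@Sc n) (Sann n).
  exists x => _; have nthr i : (i < n)%N -> nth 0 (rcons h x) i = nth 0 h i.
    by move=> ni; rewrite nth_rcons ni.
  have nthn : nth 0 (rcons h x) n = x by rewrite nth_rcons ltnn eqxx.
  have sumr a m : (m <= n)%N -> \sum_(i < m) a i *: nth 0 (rcons h x) i =
      \sum_(i < m) a i *: nth 0 h i.
    by move=> mn; apply: eq_bigr => i _; rewrite nthr // (leq_trans _ mn).
  split; last first.
    move=> i; rewrite ltnS leq_eqVlt => /predU1P[->|ni]; first by rewrite nthn.
    by rewrite nthr //; exact: hS.
  have [_ h0 hP] := hK; split=> // [i|a i m].
    rewrite ltnS leq_eqVlt => /predU1P[->|ni]; last by rewrite nthr // h0.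
    by rewrite nthn -normr_gt0; apply: lt_trans c0 _; have /andP[] := Sc n x Sx.
  move=> /andP[im]; rewrite leq_eqVlt => /predU1P[mE|]; last first.
    rewrite ltnS => mn; rewrite !sumr ?(leq_trans im) //.
    apply: le_trans (hP a i m _) _; first by rewrite im.
    by rewrite ler_wpM2r // ltW.
  subst m; move: im; rewrite leq_eqVlt => /predU1P[->|].
    by rewrite ler_peMl.
  rewrite ltnS => ni; rewrite big_ord_recr /= nthn !sumr //.
  apply: le_trans (hP a i n _) _; first by rewrite ni /=.
  rewrite -ler_pdivlMl // mulrA [X in X * _]mulrC; exact: xP.
have /choice [pick pickP] := ext.
pose hist n := iter n (fun h => rcons h (pick h)) [::].
have size_hist n : size (hist n) = n by elim: n => //= n IH;
  rewrite size_rcons IH.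
have hist_good n : good n (nth 0 (hist n)).
  elim: n => [|n IH]; last by have := pickP (hist n);
    rewrite size_hist => /(_ IH).
  split=> //; split=> // [a i m]; rewrite leqn0 => /andP[im /eqP m0].
  by move: im; rewrite m0 leqn0 => /eqP ->; rewrite !big_ord0 normr0 mulr0.
pose x n := pick (hist n).
have nth_hist i n : (i < n)%N -> nth 0 (hist n) i = x i.
  elim: n => // n IH; rewrite ltnS leq_eqVlt /= nth_rcons size_hist.
  by case/predU1P => [->|ni]; [rewrite ltnn eqxx | rewrite ni IH].
exists x => [i|].
  by have [_ /(_ i (ltnSn i))] := hist_good i.+1; rewrite nth_hist.
apply: K_basic_of_fin => N; have [[_ h0 hP] _] := hist_good N; split.
- exact: ler1n.
- by move=> i iN; have := h0 i iN; rewrite nth_hist.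
- move=> a n m /andP[nm mN].
  have sumE k : (k <= N)%N -> \sum_(i < k) a i *: nth 0 (hist N) i =
      \sum_(i < k) a i *: x i.
    by move=> kN; apply: eq_bigr => i _; rewrite nth_hist // (leq_trans _ kN).
  have := hP a n m; rewrite nm mN => /(_ isT).
  rewrite !sumE ?(leq_trans nm) // => /le_trans; apply.
  by rewrite ler_wpM2r.
Qed.

End BasicSelection.

(** * Oscillation of a Riemann integrable function *)

Lemma sum_blocks (V : nmodType) (F : nat -> V) (a b : nat) :
  \sum_(u < a * b) F u = \sum_(j < a) \sum_(u < b) F (j * b + u)%N.
Proof.
elim: a => [|a IH]; first by rewrite !big_ord0.
by rewrite mulSnr big_split_ord big_ord_recr /= IH.
Qed.

Section RiemannOscillation.
Variables (R : realType) (X : completeNormedModType R) (f : R -> X).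
Hypothesis f_int : riemann_integrable f.
Implicit Types (c : R) (m j r u n : nat) (t : R).

Definition dyadic m j : R := j%:R / 2 ^+ m.
Definition in_dyadic m j t := dyadic m j <= t <= dyadic m j.+1.

Lemma dyadic_step m j : dyadic m j.+1 - dyadic m j = (2 ^+ m)^-1.
Proof. by rewrite -mulrBl -natr1 addrAC subrr add0r mul1r. Qed.

Lemma dyadic_left m j : in_dyadic m j (dyadic m j).
Proof.
rewrite /in_dyadic lexx /= -subr_ge0 dyadic_step invr_ge0.
exact: exprn_ge0.
Qed.

Lemma dyadic_half m j : dyadic m.+1 (2 * j)%N = dyadic m j.
Proof. by rewrite /dyadic exprS natrM -mulf_div divff ?mul1r // pnatr_eq0. Qed.

Lemma dyadic_le m j k : (j <= k)%N -> dyadic m j <= dyadic m k.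
Proof. by move=> jk; rewrite ler_pM2r ?invr_gt0 ?exprn_gt0 // ler_nat. Qed.

Lemma in_dyadic_parent m j (b : 'I_2) t :
  in_dyadic m.+1 (j * 2 + b)%N t -> in_dyadic m j t.
Proof.
move=> /andP[h1 h2]; rewrite /in_dyadic -!(dyadic_half m); apply/andP; split.
  by apply: le_trans h1; apply: dyadic_le; lia.
by apply: le_trans h2 _; apply: dyadic_le; have := ltn_ord b; lia.
Qed.

Lemma in_dyadic_unit m j t : (j < 2 ^ m)%N -> in_dyadic m j t -> 0 <= t <= 1.
Proof.
move=> jm /andP[h1 h2]; apply/andP; split.
  by apply: le_trans h1; rewrite divr_ge0 // exprn_ge0.
apply: le_trans h2 _; rewrite ler_pdivrMr ?exprn_gt0 // mul1r.
by rewrite -natrX ler_nat.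
Qed.

Lemma dyadic_cover m t :
  0 <= t <= 1 -> exists2 j, (j < 2 ^ m)%N & in_dyadic m j t.
Proof.
move=> /andP[t0 t1].
have p0 : 0 < 2 ^+ m :> R by rewrite exprn_gt0.
have [tlt|] := ltP t 1.
  have tm0 : 0 <= t * 2 ^+ m by rewrite mulr_ge0 // ltW.
  have /andP[h1 h2] := truncn_itv tm0.
  exists (Num.truncn (t * 2 ^+ m)).
    rewrite -(ltr_nat R) natrX; apply: le_lt_trans h1 _.
    by rewrite gtr_pMl.
  by rewrite /in_dyadic /dyadic ler_pdivrMr // h1 ler_pdivlMr // ltW.
move=> t1'; have -> : t = 1 by apply/eqP; rewrite eq_le t1 t1'.
have m0 : (0 < 2 ^ m)%N by rewrite expn_gt0.
exists (2 ^ m).-1; first by rewrite prednK.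
rewrite /in_dyadic prednK // /dyadic natrX divff ?gt_eqF // lexx andbT.
by rewrite ler_pdivrMr // mul1r -natrX ler_nat leq_pred.
Qed.

(** Two Riemann sums over the same fine dyadic partition are both within [eps / 2] of the
    integral. *)
Lemma dyadic_sums (eps : R) : 0 < eps -> exists m0, forall m, (m0 <= m)%N ->
  forall t t' : nat -> R,
    (forall j, (j < 2 ^ m)%N -> in_dyadic m j (t j) /\ in_dyadic m j (t' j)) ->
    `|\sum_(j < 2 ^ m) (f (t j) - f (t' j))| <= eps * 2 ^+ m.
Proof.
move=> e0; have [xf xfP] := f_int.
have h0 : 0 < eps / 2 by rewrite divr_gt0.
have [delta d0 dP] := xfP _ h0.
exists (Num.truncn delta^-1).+1 => m mm t t' tt'.
have p0 : 0 < 2 ^+ m :> R by rewrite exprn_gt0.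
have md : (2 ^+ m)^-1 < delta.
  rewrite -[delta]invrK ltf_pV2 ?posrE ?invr_gt0 //.
  apply: lt_le_trans (truncnS_gt _) _; rewrite -natrX ler_nat.
  by apply: leq_trans mm (ltnW _); exact: ltn_expl.
have H (s : nat -> R) : (forall j, (j < 2 ^ m)%N -> in_dyadic m j (s j)) ->
    `|xf - (2 ^+ m)^-1 *: \sum_(j < 2 ^ m) f (s j)| < eps / 2.
  move=> sP; have := dP (2 ^ m)%N (dyadic m) s.
  rewrite scaler_sumr; under [in X in X -> _]eq_bigr do rewrite dyadic_step.
  apply => //.
  - by rewrite /dyadic mul0r.
  - by rewrite /dyadic natrX divff // gt_eqF.
  - by move=> i _; rewrite -subr_gt0 dyadic_step invr_gt0.
  - by move=> i _; rewrite dyadic_step.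
have h1 := H t (fun j jm => (tt' j jm).1).
have h2 := H t' (fun j jm => (tt' j jm).2).
rewrite sumrB -ler_pdivrMr // mulrC -[(2 ^+ m)^-1]ger0_norm ?invr_ge0 ?ltW //.
rewrite -normrZ scalerBr; set A := _ *: _ in h1 *; set B := _ *: _ in h2 *.
have -> : A - B = (xf - B) - (xf - A) by rewrite opprB [RHS]addrC addrA subrK.
by apply: le_lt_trans (ler_normB _ _) _; lra.
Qed.

(** Moving a single tag of a fixed dyadic partition changes the sum of values by at most
    [2 ^+ m]. *)
Lemma riemann_bounded : exists B, forall t t', 0 <= t <= 1 -> 0 <= t' <= 1 ->
  `|f t - f t'| <= B.
Proof.
have [m mP] := dyadic_sums ltr01.
pose M := 2 ^+ m + \sum_(j < 2 ^ m) `|f (dyadic m j)|.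
have fM t : 0 <= t <= 1 -> `|f t| <= M.
  move=> t01; have [j jm tj] := dyadic_cover m t01.
  rewrite -[f t](subrK (f (dyadic m j))); apply: le_trans (ler_normD _ _) _.
  apply: lerD; last by rewrite (bigD1 (Ordinal jm)) //= lerDl sumr_ge0.
  have := mP m (leqnn m) (fun k => if k == j then t else dyadic m k) (dyadic m).
  rewrite (bigD1 (Ordinal jm)) //= eqxx big1 ?addr0 ?mul1r; last first.
    by move=> k; rewrite -val_eqE /= => /negbTE ->; rewrite subrr.
  apply=> k km; split; last exact: dyadic_left.
  by case: eqP => [->|_] //; exact: dyadic_left.
exists (M + M) => t t' t01 t'01.
by apply: le_trans (ler_normB _ _) _; apply: lerD; exact: fM.
Qed.

Definition osc c m j := exists t t',
  [/\ in_dyadic m j t, in_dyadic m j t' & c < `|f t - f t'|].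

Definition osc_count c m j r : nat :=
  (\sum_(u < 2 ^ r) `[<osc c (m + r) (j * 2 ^ r + u)>])%N.

(** A counting substitute for positive measure of the points of oscillation above [c] in the
    interval. *)
Definition charged c m j := exists2 eta : R, 0 < eta &
  forall r, eta * 2 ^+ r <= (osc_count c m j r)%:R.

Lemma osc_count_le c m j r : (osc_count c m j r <= 2 ^ r)%N.
Proof.
rewrite -[leqRHS]card_ord -sum1_card; apply: leq_sum => u _; exact: leq_b1.
Qed.

(** The parent of an oscillating interval oscillates, so the proportion of oscillating intervals
    does not grow with the depth. *)
Lemma osc_countS c m j r : (osc_count c m j r.+1 <= 2 * osc_count c m j r)%N.
Proof.
rewrite /osc_count expnSr (sum_blocks (fun u =>
  nat_of_bool `[<osc c _ (_ + u)>])).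
rewrite big_distrr /=; apply: leq_sum => u _.
have [nosc|nosc] := pselect (osc c (m + r) (j * 2 ^ r + u)%N).
  rewrite asboolT // muln1; apply: (@leq_trans (\sum_(b < 2) 1)).
    by apply: leq_sum => b _; exact: leq_b1.
  by rewrite sum1_card card_ord.
rewrite big1 // => b _; rewrite asboolF //; apply: contra_not nosc.
move=> [t [t' [h1 h2 h3]]]; exists t, t'.
have E : (j * (2 ^ r * 2) + (u * 2 + b) = (j * 2 ^ r + u) * 2 + b)%N by ring.
rewrite addnS E in h1 h2.
by split=> //; [exact: in_dyadic_parent h1 | exact: in_dyadic_parent h2].
Qed.

Lemma osc_count_mono c m j (eta : R) r r' : (r <= r')%N ->
  (osc_count c m j r)%:R <= eta * 2 ^+ r ->
  (osc_count c m j r')%:R <= eta * 2 ^+ r'.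
Proof.
move=> /subnKC <- H; elim: (r' - r)%N => [|k IH]; first by rewrite addn0.
rewrite addnS exprS mulrCA; apply: le_trans (ler_wpM2l _ IH) => //.
by rewrite -natrM ler_nat osc_countS.
Qed.

Lemma osc_count_split c m r :
  osc_count c 0 0 (m + r) = (\sum_(j < 2 ^ m) osc_count c m j r)%N.
Proof.
rewrite /osc_count expnD; under eq_bigr do rewrite mul0n !add0n.
exact: (sum_blocks (fun u => nat_of_bool `[<osc c (m + r) u>])).
Qed.

(** At a common depth [rm] every uncharged interval of level [m] has proportion at most [eta / 2];
    the other half of the total must come from charged ones. *)
Lemma charged_many c : charged c 0 0 -> exists2 eta : R, 0 < eta &
  forall m, eta * 2 ^+ m <= (\sum_(j < 2 ^ m) `[<charged c m j>])%N%:R.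
Proof.
move=> [eta eta0 etaP]; exists (eta / 2) => [|m]; first by rewrite divr_gt0.
have h0 : 0 < eta / 2 by rewrite divr_gt0.
have /choice [r rP] j : exists r, ~ charged c m j ->
    (osc_count c m j r)%:R <= eta / 2 * 2 ^+ r.
  have [cj|ncj] := pselect (charged c m j); first by exists 0%N.
  apply: contrapT => H; apply: ncj; exists (eta / 2) => // r.
  rewrite leNgt; apply/negP => /ltW lt; apply: H.
  by exists r.
pose rm := (\max_(j < 2 ^ m) r j)%N.
have rm_ge j : (j < 2 ^ m)%N -> (r j <= rm)%N.
  by move=> jm; exact: (leq_bigmax (Ordinal jm)).
have p0 : 0 < 2 ^+ rm :> R by rewrite exprn_gt0.
have := etaP (m + rm)%N; rewrite osc_count_split natr_sum.
have le_each (j : 'I_(2 ^ m)) : (osc_count c m j rm)%:R <=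
    (`[<charged c m j>] : nat)%:R * 2 ^+ rm + eta / 2 * 2 ^+ rm :> R.
  have [cj|ncj] := pselect (charged c m j).
    rewrite asboolT // mul1r; apply: (@le_trans _ _ (2 ^+ rm)).
      by rewrite -natrX ler_nat osc_count_le.
    by rewrite lerDl mulr_ge0 ?ltW.
  rewrite asboolF // mul0r add0r; apply: osc_count_mono (rP j ncj).
  exact: rm_ge.
have sum_each : \sum_(j < 2 ^ m) (osc_count c m j rm)%:R <= \sum_(j < 2 ^ m)
    ((`[<charged c m j>] : nat)%:R * 2 ^+ rm + eta / 2 * 2 ^+ rm) :> R.
  by apply: ler_sum => j _; exact: le_each.
move=> /le_trans /(_ sum_each).
rewrite big_split /= -mulr_suml -natr_sum sumr_const card_ord.
rewrite -[_ *+ 2 ^ m]mulr_natr natrX exprD.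
set S := (\sum_(j < _) _)%N; set p := 2 ^+ m; set q := 2 ^+ rm in p0 *.
have -> : eta * (p * q) = (eta * p) * q by ring.
have -> : S%:R * q + eta / 2 * q * p = (S%:R + eta / 2 * p) * q by ring.
by rewrite ler_pM2r //; lra.
Qed.

Definition lowering (g : X) (s eps : R) n u := exists t t',
  [/\ in_dyadic n u t, in_dyadic n u t' &
   `|g + s *: (f t - f t')| < `|g| - eps].

(* If many intervals carried a difference lowering the norm of g, the average
   of these differences would lower it too, but it is small by integrability. *)
Lemma bad_intervals_rare (g : X) (s eps eta : R) : 0 < eps -> 0 < eta ->
  exists m0, forall n, (m0 <= n)%N ->
    (\sum_(u < 2 ^ n) `[<lowering g s eps n u>])%N%:R <= eta * 2 ^+ n.
Proof.
move=> e0 eta0; pose e1 := eps * eta / (`|s| + 1).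
have s0 : 0 < `|s| + 1 by rewrite ltr_wpDl.
have e10 : 0 < e1 by rewrite divr_gt0 // mulr_gt0.
have [m0 m0P] := dyadic_sums e10; exists m0 => n m0n.
pose bad u := lowering g s eps n u.
(* Intervals that are not bad get two equal tags, so only the bad ones contribute to the sum of
   differences. *)
have /choice [p pP] u : exists p : R * R,
    [/\ in_dyadic n u p.1, in_dyadic n u p.2 &
     if `[<bad u>] then (`|g + s *: (f p.1 - f p.2)| < `|g| - eps : Prop)
     else p.1 = p.2].
  have [bu|nbu] := pselect (bad u).
    by rewrite asboolT //; have [t [t' [h1 h2 h3]]] := bu; exists (t, t').
  rewrite asboolF //; exists (dyadic n u, dyadic n u).
  by split=> //=; exact: dyadic_left.
set M := (\sum_(u < 2 ^ n) _)%N.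
have small : `|\sum_(u < 2 ^ n) (f (p u).1 - f (p u).2)| <= e1 * 2 ^+ n.
  apply: (m0P n m0n (fun u => (p u).1) (fun u => (p u).2)) => u _.
  by have [h1 h2 _] := pP u.
have H : `|\sum_(u < 2 ^ n | `[<bad u>]) (g + s *: (f (p u).1 - f (p u).2))| <=
    M%:R * (`|g| - eps).
  apply: le_trans (ler_norm_sum _ _ _) _.
  rewrite natr_sum mulr_suml big_mkcond /=; apply: ler_sum => u _.
  have [_ _] := pP u; case: ifP => _; last by rewrite mul0r.
  by rewrite mul1r => /ltW.
have E : \sum_(u < 2 ^ n | `[<bad u>]) (g + s *: (f (p u).1 - f (p u).2)) =
    M%:R *: g + s *: \sum_(u < 2 ^ n) (f (p u).1 - f (p u).2).
  rewrite scaler_sumr natr_sum scaler_suml -big_split big_mkcond /=.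
  apply: eq_bigr => u _; have [_ _] := pP u; case: ifP => _;
    first by rewrite scale1r.
  by move=> ->; rewrite subrr scaler0 scale0r addr0.
rewrite E in H.
set T := \sum_(u < 2 ^ n) _ in small H.
have H1 := lerB_normD (M%:R *: g) (s *: T).
have H2 : `|s *: T| <= eps * (eta * 2 ^+ n).
  rewrite normrZ; apply: (@le_trans _ _ ((`|s| + 1) * (e1 * 2 ^+ n))).
    by apply: ler_pM => //; rewrite lerDl.
  by rewrite /e1 le_eqVlt; apply/orP; left; apply/eqP; field; rewrite gt_eqF.
rewrite normrZ ger0_norm // in H1.
have H3 : M%:R * (`|g| - eps) = M%:R * `|g| - eps * M%:R by ring.
rewrite -(ler_pM2l e0); rewrite H3 in H; lra.
Qed.

(** Deep inside the interval the oscillating subintervals outnumber those that are bad for some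
    [g k], so one of them is oscillating and not bad. *)
Lemma charged_almost_annihilated c B m j : (j < 2 ^ m)%N -> charged c m j ->
  (forall t t', 0 <= t <= 1 -> 0 <= t' <= 1 -> `|f t - f t'| <= B) ->
  almost_annihilated [set x : X | exists t t',
    [/\ in_dyadic m j t, in_dyadic m j t', x = f t - f t' & c < `|x| <= B]].
Proof.
move=> jm [eta eta0 etaP] fB I g s eps e0.
(* Bad intervals are counted over all of [[0, 1]], whence [2 ^+ m]; the successor of [#|I|] makes
   the comparison strict. *)
pose eta' := eta / (2 ^+ m * #|I|.+1%:R).
have p0 : 0 < 2 ^+ m :> R by rewrite exprn_gt0.
have eta'0 : 0 < eta' by rewrite divr_gt0 // mulr_gt0.
have /choice [m0 m0P] (k : I) := bad_intervals_rare (g k) (s k) e0 eta'0.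
pose r := (\max_(k : I) m0 k)%N.
pose bad k u := lowering (g k) (s k) eps (m + r) u.
have badP k : (\sum_(u < 2 ^ r) `[<bad k (j * 2 ^ r + u)%N>])%N%:R <=
  eta' * 2 ^+ (m + r).
  apply: le_trans (m0P k (m + r)%N _); last first.
    by rewrite (leq_trans (leq_bigmax k)) ?leq_addl.
  rewrite ler_nat expnD (sum_blocks (fun u => nat_of_bool `[<bad k u>])).
  by rewrite (bigD1 (Ordinal jm)) //= leq_addr.
have [u uosc unb] : exists2 u : 'I_(2 ^ r), osc c (m + r) (j * 2 ^ r + u)
    & forall k, ~ bad k (j * 2 ^ r + u)%N.
  apply: contrapT => H.
  have : (osc_count c m j r <=
      \sum_(k : I) \sum_(u < 2 ^ r) `[<bad k (j * 2 ^ r + u)%N>])%N.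
    rewrite exchange_big /=; apply: leq_sum => u _.
    have [uo|] := pselect (osc c (m + r) (j * 2 ^ r + u)%N);
      last by move=> /asboolF ->.
    rewrite asboolT //; have [[k kb]|nk] := pselect (exists k, bad k (j * 2 ^ r
      + u)%N).
      by rewrite (bigD1 k) //= asboolT // leq_addr.
    by exfalso; apply: H; exists u => // k kb; apply: nk; exists k.
  rewrite -(ler_nat R) natr_sum => /(le_trans (etaP r)).
  have sum_bad : \sum_(k : I)
      (\sum_(u < 2 ^ r) `[<bad k (j * 2 ^ r + u)%N>])%N%:R <=
      \sum_(k : I) eta' * 2 ^+ (m + r).
    by apply: ler_sum => k _; exact: badP.
  move=> /le_trans /(_ sum_bad).
  have cI : #|(xpredT : pred I)| = #|I| by exact: eq_card.
  rewrite sumr_const cI -[_ *+ #|I|]mulr_natr /eta' exprD.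
  have q0 : 0 < 2 ^+ r :> R by rewrite exprn_gt0.
  have -> : eta / (2 ^+ m * #|I|.+1%:R) * (2 ^+ m * 2 ^+ r) * #|I|%:R =
      eta * 2 ^+ r * (#|I|%:R / #|I|.+1%:R).
    by field; rewrite !gt_eqF.
  rewrite -[X in X <= _]mulr1 ler_pM2l ?mulr_gt0 // ler_pdivlMr // mul1r.
  by rewrite ler_nat ltnn.
have nest v w t : (w <
  2 ^ v)%N -> in_dyadic (m + v) (j * 2 ^ v + w)%N t -> in_dyadic m j t.
  clear; elim: v w => [|v IH] w.
    by rewrite expn0 ltnS leqn0 => /eqP ->; rewrite muln1 !addn0.
  rewrite addnS expnS => wv.
  have b2 : (w %% 2 < 2)%N by rewrite ltn_mod.
  have -> : (j * (2 * 2 ^ v) + w = (j * 2 ^ v + w %/ 2) * 2 + Ordinal b2)%N.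
    by rewrite /= {1}(divn_eq w 2); ring.
  move/in_dyadic_parent; apply: IH.
  by rewrite ltn_divLR // mulnC.
have [t [t' [h1 h2 h3]]] := uosc.
have t1 := nest _ _ _ (ltn_ord u) h1; have t2 := nest _ _ _ (ltn_ord u) h2.
exists (f t - f t').
  exists t, t'; split=> //; rewrite h3 fB //; exact: in_dyadic_unit jm _.
move=> k; rewrite leNgt; apply/negP => lt; apply: (unb k).
by exists t, t'; split.
Qed.

End RiemannOscillation.

(** * The Lebesgue property *)

Section LebesgueProperty.
Variables (R : realType) (X : completeNormedModType R) (f : R -> X).
Hypothesis f_int : riemann_integrable f.

(** A nondyadic [x] is interior to its dyadic interval; without oscillation there, that interval
    would be a neighbourhood on which [f] stays within [c] of [f x]. *)
Lemma discontinuities_cover (c : R) (r : nat) (x : R) :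
  0 <= x <= 1 -> (forall m j, x != dyadic R m j) ->
  ~ (exists2 d, 0 < d & forall y, `|x - y| < d -> 0 <= y <=
    1 -> `|f x - f y| <= c) ->
  exists2 u, (u < 2 ^ r)%N & osc f c r u /\ in_dyadic r u x.
Proof.
move=> x01 xd ncont; have [u ur xu] := dyadic_cover r x01.
exists u => //; split=> //; apply: contrapT => nosc; apply: ncont.
have /andP[x1 x2] := xu.
have {}x1 : dyadic R r u < x by rewrite lt_neqAle eq_sym xd.
have {}x2 : x < dyadic R r u.+1 by rewrite lt_neqAle xd.
exists (Num.min (x - dyadic R r u) (dyadic R r u.+1 - x)).
  by rewrite lt_min !subr_gt0 x1.
move=> y; rewrite lt_min !ltr_norml => /andP[/andP[_ y1] /andP[y2 _]] _.
rewrite leNgt; apply/negP => lt; apply: nosc; exists x, y; split=> //.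
by apply/andP; split; lra.
Qed.

(** For each [q] the nondyadic points of oscillation above [1 / (q + 1)] are covered by the
    oscillating intervals of any level. Their total length is at most [1 / (k + 1)] at a suitable
    level [r k]. *)
Lemma uncharged_continuous_ae : (forall q, ~ charged f q.+1%:R^-1 0 0) ->
  {ae @lebesgue_measure R, forall x : R, 0 <= x <= 1 ->
     f y @[y --> within `[0%R, 1%R] (nbhs x)] --> f x}.
Proof.
move=> unch.
pose cont (q : nat) x := exists2 d, 0 < d & forall y,
  `|x - y| < d -> 0 <= y <= 1 -> `|f x - f y| <= q.+1%:R^-1.
pose D := \bigcup_m \bigcup_j [set dyadic R m j].
pose Z q := [set x | [/\ 0 <= x <= 1, forall m j, x != dyadic R m j &
  ~ cont q x]].
have Dnull : (@lebesgue_measure R).-negligible D.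
  have Dc : countable D by do 2 (apply: bigcup_countable => // ? _).
  exists D; split=> //; last exact: countable_lebesgue_measure0.
  apply: bigcupT_measurable => m; apply: bigcupT_measurable => j.
  exact: measurable_set1.
have Znull q : (@lebesgue_measure R).-negligible (Z q).
  have /choice [r rP] k : exists r,
      (osc_count f q.+1%:R^-1 0 0 r)%:R <= k.+1%:R^-1 * 2 ^+ r :> R.
    apply: contrapT => H; apply: (unch q); exists k.+1%:R^-1.
      by rewrite invr_gt0.
    by move=> r; rewrite leNgt; apply/negP => /ltW lt; apply: H; exists r.
  pose J k u : set R := if `[<osc f q.+1%:R^-1 (r k) u>]
    then `[dyadic R (r k) u, dyadic R (r k) u.+1]%classic else set0.
  pose W k := \big[setU/set0]_(u < 2 ^ r k) J k u.
  have Jm k u : measurable (J k u).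
    by rewrite /J; case: ifP => _; [exact: measurable_itv | exact: measurable0].
  have Wm k : measurable (W k) by apply: bigsetU_measurable => u _; exact: Jm.
  have JE k u : (lebesgue_measure (J k u) =
      ((`[<osc f q.+1%:R^-1 (r k) u>] : nat)%:R * (2 ^+ r k)^-1)%:E)%E.
    rewrite /J; case: ifP => _; last by rewrite measure0 mul0r.
    rewrite lebesgue_measure_itv /= lte_fin -subr_gt0 dyadic_step.
    by rewrite invr_gt0 exprn_gt0 // -EFinB dyadic_step mul1r.
  have Wle k : (lebesgue_measure (W k) <= (k.+1%:R^-1)%:E)%E.
    apply: le_trans (Boole_inequality _ _) _; first by move=> i _; exact: Jm.
    rewrite (eq_bigr _ (fun (u : 'I_(2 ^ r k)) _ =>
      JE k u)) sumEFin lee_fin -mulr_suml ler_pdivrMr ?exprn_gt0 //.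
    rewrite -natr_sum; apply: le_trans (rP k); rewrite ler_nat /osc_count.
    by under [leqRHS]eq_bigr do rewrite mul0n !add0n.
  exists (\bigcap_k W k); split.
  - exact: bigcapT_measurable.
  - apply/eqP; rewrite eq_le measure_ge0 andbT; apply/lee_addgt0Pr => eps e0.
    rewrite add0e; apply:
      (@le_trans _ _ (lebesgue_measure (W (Num.truncn eps^-1)))).
      apply: le_measure; rewrite ?inE //; first exact: bigcapT_measurable.
        exact: Wm.
      by move=> x; exact.
    apply: le_trans (Wle _) _; rewrite lee_fin -[eps in X in _ <= X]invrK.
    by rewrite lef_pV2 ?posrE ?invr_gt0 // ltW // truncnS_gt.
  - move=> x [x01 xd nc] k _.
    have [u ur [uo xu]] := discontinuities_cover (r k) x01 xd nc.
    rewrite /W -bigcup_mkord; exists u => //.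
    by rewrite /J asboolT //= in_itv.
apply: (negligibleS _ (negligibleU Dnull (negligible_bigcup Znull))).
move=> x /= H; apply: contrapT => nx; apply: H => x01.
have xd m j : x != dyadic R m j.
  by apply/eqP => xE; apply: nx; left; exists m => //; exists j.
have xc q : cont q x.
  by apply: contrapT => nc; apply: nx; right; exists q.
apply/cvgrPdist_le => eps e0.
have [d d0 dP] := xc (Num.truncn eps^-1).
have qe : (Num.truncn eps^-1).+1%:R^-1 <= eps.
  rewrite -[leRHS]invrK lef_pV2 ?posrE ?invr_gt0 // ltW //.
  exact: truncnS_gt.
near=> y; apply: le_trans qe; apply: dP.
  near: y; apply: cvg_within; exists d => // y.
near: y; apply: withinT.
Unshelve. all: by end_near. Qed.

Lemma charged_contradiction (c : R) : 0 < c -> charged f c 0 0 ->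
  (forall (V : completeNormedModType R) (x : nat -> nat -> X) (v : nat -> V),
     asymptotic_model x v -> equivalent_to_ell1_basis v) -> False.
Proof.
move=> c0 ch ell1.
have [B0 B0P] := riemann_bounded f_int.
pose B := Num.max 1 B0.
have B1 : 1 <= B by rewrite le_max lexx.
have Bp : 0 < B by apply: lt_le_trans B1.
have BP t t' : 0 <= t <= 1 -> 0 <= t' <= 1 -> `|f t - f t'| <= B.
  by move=> t1 t2; apply: le_trans (B0P _ _ t1 t2) _; rewrite le_max lexx orbT.
pose lvl k := trunc_log 2 k; pose idx k := (k - 2 ^ lvl k)%N.
pose good k := (0 < k)%N /\ charged f c (lvl k) (idx k).
(* [node] takes each value infinitely often; [k = 2 ^ m + j] encodes the
   dyadic interval [(m, j)]. *)
pose node i := (i - 2 ^ trunc_log 2 i)%N.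
(* A node that codes no charged interval is replaced by the unit interval, which is charged by
   hypothesis. *)
pose iv i := if `[<good (node i)>] then (lvl (node i), idx (node i)) else (0%N,
  0%N).
have trunc_logD m j : (j < 2 ^ m)%N -> trunc_log 2 (2 ^ m + j) = m.
  move=> jm; apply: trunc_log_eq => //.
  by rewrite leq_addr /= expnS mul2n -addnn ltn_add2l.
have idx_lt k : (0 < k)%N -> (idx k < 2 ^ lvl k)%N.
  move=> k0; have /andP[h1 h2] := @trunc_log_bounds 2 k isT k0.
  by rewrite ltn_subLR // addnn -mul2n -expnS.
have ivP i : ((iv i).2 < 2 ^ (iv i).1)%N /\ charged f c (iv i).1 (iv i).2.
  rewrite /iv; case: asboolP => [[k0 kc]|_] //=.
  by split=> //; exact: idx_lt.
pose S i := [set x : X | exists t t', [/\ in_dyadic (iv i).1 (iv i).2 t,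
  in_dyadic (iv i).1 (iv i).2 t', x = f t - f t' & c < `|x| <= B]].
have S_norm i x : S i x -> c < `|x| <= B by case=> t [t' []].
have S_ann i : almost_annihilated (S i).
  have [h1 h2] := ivP i.
  exact: (charged_almost_annihilated f_int h1 h2 BP).
have [x Sx xb] := basic_selection c0 S_norm S_ann.
have x0 i : 0 < `|x i| by have /andP[h _] := S_norm i _ (Sx i);
  apply: lt_trans h.
pose w i := `|x i|^-1 *: x i.
have w1 : normalized w.
  by move=> i; rewrite normrZ normfV normr_id mulVf // gt_eqF.
have wb : basic w.
  have [K1 _ xK] := xb; exists 2; split=> // [i|a n m nm].
    by rewrite -normr_gt0 w1.
  have E k : \sum_(i < k) a i *: w i = \sum_(i < k) (a i / `|x i|) *: x i.
    by apply: eq_bigr => i _; rewrite scalerA.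
  by rewrite !E; exact: (xK (fun i => a i / `|x i|)).
pose Bk k := [set i | good k -> node i = k].
have Bk_inf k : infinite_set (Bk k).
  apply/infinite_natP => n; exists (2 ^ (n + k) + k)%N.
  have k2 : (k < 2 ^ (n + k))%N by apply:
    leq_ltn_trans (leq_addl n k) (ltn_expl _ _).
  split; last by move=> _; rewrite /node trunc_logD // addKn.
  have : (n + k < 2 ^ (n + k))%N by exact: ltn_expl.
  by move: (2 ^ _)%N; clear; lia.
have [V [z [v [_ zv zB]]]] := block_asymptotic_model w1 wb Bk_inf.
have [C C0 Cv] := ell1 V z v zv.
have [eta eta0 etaP] := charged_many ch.
(* In units of [rho / B * 2 ^+ m], the model norm is at least 4, whereas integrability gives at most
   1 and the approximation error is below 1. *)
pose rho := C^-1 * c * eta / 4.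
have rho0 : 0 < rho by rewrite divr_gt0 // !mulr_gt0 // invr_gt0.
have [m mP] := dyadic_sums f_int rho0.
have {mP} := mP m (leqnn m).
have rhoB0 : 0 < rho / B by rewrite divr_gt0.
have [_ _ _ iso] := zv.
have [N NP] := asymptotically_isometric_near (2 ^ m + 2 ^ m) iso rhoB0.
have /choice [l lP] k : exists l, Bk k l /\ z k (N + k)%N = w l.
  by have [l [_ ? ?]] := zB k (N + k)%N (leq_addl _ _); exists l.
pose ch' j := `[<charged f c m j>].
have iv_l j : (j < 2 ^ m)%N -> charged f c m j -> iv (l (2 ^ m + j)%N) = (m, j).
  move=> jm cj; have [Bl _] := lP (2 ^ m + j)%N.
  have gk : good (2 ^ m + j)%N.
    by split; [rewrite addn_gt0 expn_gt0 | rewrite /idx /lvl trunc_logD //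
      addKn].
  by rewrite /iv (Bl gk) asboolT // /idx /lvl trunc_logD // addKn.
(* Tags realizing the selected difference on each charged interval of level [m] and 0 on the
   others. *)
have /choice [p pP] j : exists p : R * R, (j < 2 ^ m)%N ->
    [/\ in_dyadic m j p.1, in_dyadic m j p.2 &
     f p.1 - f p.2 = if ch' j then x (l (2 ^ m + j)%N) else 0].
  have [jm|jm] := ltnP j (2 ^ m); last by exists (0, 0).
  have [cj|ncj] := pselect (charged f c m j).
    have [t [t' [h1 h2 h3 _]]] := Sx (l (2 ^ m + j)%N).
    rewrite iv_l //= in h1 h2; exists (t, t') => _; split=> //.
    by rewrite /ch' asboolT.
  exists (dyadic R m j, dyadic R m j) => _.
  by split; rewrite ?dyadic_left // /ch' asboolF //= subrr.
move=> /(_ (fun j => (p j).1) (fun j => (p j).2)) => small.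
have {}small : `|\sum_(j < 2 ^ m) (if ch' j then x (l (2 ^ m + j)%N) else 0)| <=
    rho * 2 ^+ m.
  rewrite (eq_bigr (fun j : 'I_(2 ^ m) => f (p j).1 - f (p j).2)).
    by apply: small => j jm; have [h1 h2 _] := pP j jm.
  by move=> j _; have [_ _ ->] := pP j (ltn_ord j).
(* Undoes the normalization of [w] up to the factor [B^-1], which keeps the coefficients at most
   1. *)
pose a k : R := if (2 ^ m <=
  k)%N && ch' (k - 2 ^ m)%N then `|x (l k)| / B else 0.
have i1 j : (j < 2 ^ m + 2 ^ m)%N -> (N <= (N + j).+1)%N.
  by move=> _; exact: leqW (leq_addr _ _).
have i2 j k : (j < k < 2 ^ m + 2 ^ m)%N -> (N + j < N + k)%N.
  by move=> /andP[jk _]; rewrite ltn_add2l.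
have i3 j : (j < 2 ^ m + 2 ^ m)%N -> `|a j| <= 1.
  move=> _; rewrite /a; case: ifP => _; last by rewrite normr0.
  rewrite normrM normfV normr_id (gtr0_norm Bp) ler_pdivrMr // mul1r.
  by have /andP[] := S_norm _ _ (Sx (l j)).
have := NP (addn N) a i1 i2 i3.
have -> : \sum_(j < 2 ^ m + 2 ^ m) a j *: z j (N + j)%N =
    B^-1 *: \sum_(j < 2 ^ m) (if ch' j then x (l (2 ^ m + j)%N) else 0).
  rewrite big_split_ord /= big1 ?add0r => [|j _]; last first.
    by rewrite /a leqNgt ltn_ord scale0r.
  rewrite scaler_sumr; apply: eq_bigr => j _.
  rewrite /a leq_addr addKn /=; case: ifP => _; last by rewrite scale0r scaler0.
  have [_ ->] := lP (2 ^ m + j)%N;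
    rewrite /w scalerA mulrC mulrA mulVf ?mul1r //.
  by rewrite gt_eqF.
rewrite normrZ gtr0_norm ?invr_gt0 // => close.
have /andP[low _] := Cv (2 ^ m + 2 ^ m)%N a.
have sa : c / B * (eta * 2 ^+ m) <= \sum_(i < 2 ^ m + 2 ^ m) `|a i|.
  rewrite big_split_ord /= [X in X + _]big1 ?add0r => [|j _]; last first.
    by rewrite /a leqNgt ltn_ord normr0.
  apply: (@le_trans _ _ (c / B * (\sum_(j < 2 ^ m) `[<charged f c m j>])%N%:R)).
    by rewrite ler_wpM2l // divr_ge0 // ltW.
  rewrite natr_sum mulr_sumr; apply: ler_sum => j _.
  rewrite /a leq_addr addKn /= -/(ch' j); case: ifP => _; last by rewrite mulr0.
  rewrite mulr1 normrM normfV normr_id (gtr0_norm Bp) ler_pM2r ?invr_gt0 // ltW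
    //.
  by have /andP[] := S_norm _ _ (Sx (l (2 ^ m + j)%N)).
have {sa}low : C^-1 * (c / B * (eta * 2 ^+ m)) <= `|\sum_(i <
  2 ^ m + 2 ^ m) a i *: v i|.
  by apply: le_trans low; rewrite ler_wpM2l // invr_ge0 ltW.
have E : C^-1 * (c / B * (eta * 2 ^+ m)) = 4 * (rho / B * 2 ^+ m).
  by rewrite /rho; field; rewrite !gt_eqF.
rewrite E in low.
have {}small : B^-1 * `|\sum_(j <
  2 ^ m) (if ch' j then x (l (2 ^ m + j)%N) else 0)| <=
    rho / B * 2 ^+ m.
  by rewrite [leRHS]mulrAC [leRHS]mulrC ler_pM2l ?invr_gt0.
have m1 : (1 : R) <= 2 ^+ m by rewrite exprn_ege1 // ler1n.
have h3 : rho / B <= rho / B * 2 ^+ m by rewrite ler_peMr // ltW.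
move: close low small h3; rewrite ltr_norml.
set A1 := B^-1 * _; set A2 := `|_|; set A3 := rho / B * _; set A4 := rho / B.
have : 0 < A4 by [].
by lra.
Qed.

End LebesgueProperty.

Theorem proposition4p3 (R : realType) (X : completeNormedModType R) :
  [/\ (forall e : nat -> X, normalized e -> basic e -> haar_ell1_plus e) ->
      forall (V : completeNormedModType R) (e : nat -> X) (v : nat -> V),
        spreading_model e v -> equivalent_to_ell1_basis v,
      forall e : nat -> X, normalized e -> basic e ->
        (forall (V : completeNormedModType R) (x : nat -> nat -> X)
                (v : nat -> V),
           (forall j, normalized (x j) /\ block_basis e (x j)) ->
           asymptotic_model x v -> equivalent_to_ell1_basis v) ->
        haar_ell1_plus e
    & (forall (V : completeNormedModType R) (x : nat -> nat -> X)
              (v : nat -> V),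
         asymptotic_model x v -> equivalent_to_ell1_basis v) ->
      lebesgue_property X].
Proof.
split=> [haar V e v|e|ell1 f f_int].
- exact: spreading_model_ell1.
- exact: haar_ell1_plus_of_asymptotic_models.
- apply: uncharged_continuous_ae => q ch.
  by apply: (charged_contradiction f_int _ ch ell1); rewrite invr_gt0.
Qed.
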